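(* Under the setting and standing assumptions described in the context, let $\{\tilde z_i\}$ with $\tilde z_i=z_{iN}$ be the sequence generated by the algorithm AManPG, and let $z_*$ be any accumulation point of $\{\tilde z_i\}$. Then $0\in P_{\mathrm{T}_{z_*}\mathcal{M}}\,\partial F(z_* )$, where $\partial F(z_* )$ is the Clarke generalized subdifferential of $F$ (as a function on $\mathbb{R}^{n\times p}$) at $z_*$.
   Context: Setting. $\mathcal{M}\subset\mathbb{R}^{n\times p}$ is a compact embedded Riemannian submanifold with the Frobenius inner product $\langle A,B\rangle=\mathrm{trace}(A^TB)$; $\mathrm{T}_x\mathcal{M}$ is its tangent space at $x$ and $P_{\mathrm{T}_x\mathcal{M}}$ the orthogonal projection onto it. $R$ is a smooth retraction defined on the whole tangent bundle: $R_x:\mathrm{T}_x\mathcal{M}\to\mathcal{M}$, $R_x(0)=x$, $\frac{d}{dt}R_x(t\xi)|_{t=0}=\xi$. $F=f+g$ where $f:\mathbb{R}^{n\times p}\to\mathbb{R}$ is continuously differentiable with $\nabla f$ Lipschitz with constant $L$, $g:\mathbb{R}^{n\times p}\to\mathbb{R}$ is continuous and convex, and $F$ is coercive ($F(x)\to\infty$ as $\|x\|_{\mathrm F}\to\infty$). The Riemannian gradient is $\mathrm{grad} f(x)=P_{\mathrm{T}_x\mathcal{M}}\nabla f(x)$. Weights. For each $x\in\mathcal{M}$, $W_x$ is a self-adjoint positive definite linear operator on $\mathrm{T}_x\mathcal{M}$ whose eigenvalues all lie in $[\kappa,\tilde\kappa]$ for fixed constants $0<\kappa\le\tilde\kappa$;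 $\|\eta\|_{W_x}^2=\langle\eta,W_x\eta\rangle$. Proximal direction. For $\mu>0$ and $x\in\mathcal{M}$, $\eta_x=\arg\min_{\eta\in\mathrm{T}_x\mathcal{M}}\langle\mathrm{grad} f(x),\eta\rangle+\frac{1}{2\mu}\|\eta\|_{W_x}^2+g(x+\eta)$ (unique minimizer). Algorithm AManPG. Parameters: $\mu\in(0,1/L]$, $\sigma\in(0,1)$ with $\sigma<\kappa/\mu$, $\nu\in(0,1)$, positive integer $N$. Initialize $x_0\in\mathcal{M}$, $t_0=1$, $y_0=z_0=x_0$. For $k=0,1,2,\dots$: (a) If $k$ is a multiple of $N$ (safeguard): compute $\eta_{z_k}$; let $\alpha$ be the first element of $1,\nu,\nu^2,\dots$ such that $F(R_{z_k}(\alpha\eta_{z_k}))\le F(z_k)-\sigma\alpha\|\eta_{z_k}\|_{\mathrm F}^2$; set $w=R_{z_k}(\alpha\eta_{z_k})$; if $F(w)<F(x_k)$, replace $x_k\leftarrow w$, $y_k\leftarrow w$, $t_k\leftarrow1$ (otherwise leave $x_k,y_k,t_k$ unchanged); then set $z_{k+N}=x_k$ (the possibly updated $x_k$). (b) Set $x_{k+1}=R_{y_k}(\eta_{y_k})$, $t_{k+1}=\frac{\sqrt{4t_k^2+1}+1}{2}$, and $y_{k+1}=R_{x_{k+1}}\big(\frac{1-t_k}{t_{k+1}}R_{x_{k+1}}^{-1}(x_k)\big)$, where it is assumed that the inverse retraction $R_{x_{k+1}}^{-1}(x_k)$ exists at every iteration. The sequence $\{z_k\}$ is defined only for $k$ multiple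 of $N$, and $\tilde z_i:=z_{iN}$. *)

(* Defs.v *)
From HB Require Import structures.
From mathcomp Require Import all_boot all_order all_algebra.
From mathcomp Require Import all_classical all_reals all_analysis.
Set Implicit Arguments. Unset Strict Implicit. Unset Printing Implicit Defensive.
Import Order.TTheory GRing.Theory Num.Theory.
Import numFieldTopology.Exports numFieldNormedType.Exports.
Local Open Scope ring_scope.
Local Open Scope classical_set_scope.

Section Defs.
Variables (R : realType) (n p : nat).
Local Notation E := 'M[R]_(n, p).

Definition frob (A B : E) : R := \tr (A^T *m B).
Definition frobn (A : E) : R := Num.sqrt (frob A A).

End Defs.

Fixpoint iter_derive (R : realType) (V W : normedModType R)
    (vs : seq V) (f : V -> W) : V -> W :=
  if vs is v :: vs' then (fun x => derive (iter_derive vs' f) x v) else f.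

Definition smooth_on (R : realType) (V W : normedModType R)
    (U : set V) (f : V -> W) : Prop :=
  forall (vs : seq V) (x : V), U x ->
    {for x, continuous (iter_derive vs f)} /\
    (forall v, derivable (iter_derive vs f) x v).

Section Manifold.
Variables (R : realType) (n p : nat).
Local Notation E := 'M[R]_(n, p).

Definition embedded_submanifold (M : set E) : Prop :=
  exists k : nat, forall x, M x ->
    exists (U : set E) (h : E -> 'rV[R]_k),
      [/\ open U, U x, @smooth_on R E _ U h,
          (forall y, U y -> (M y <-> h y = 0)) &
          (forall y, U y -> M y -> forall w, exists v, derive h y v = w)].

Definition tangent (M : set E) (x : E) (v : E) : Prop :=
  exists (c : R -> E) (eps : R),
    [/\ 0 < eps, smooth_on [set s : R | `|s| < eps] c,
        (forall s : R, `|s| < eps -> M (c s)),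
        c 0 = x & derive c 0 1 = v].

Definition tangent_bundle (M : set E) : set (E * E) :=
  [set u | M u.1 /\ tangent M u.1 u.2].

Definition is_orth_proj (T : set E) (v w : E) : Prop :=
  T w /\ forall u, T u -> frob (v - w) u = 0.

Definition smooth_retraction (M : set E) (Rt : E -> E -> E) : Prop :=
  [/\ (forall x xi, M x -> tangent M x xi -> M (Rt x xi)),
      (forall x, M x -> Rt x 0 = x),
      (forall x xi, M x -> tangent M x xi ->
          is_derive (0 : R) (1 : R) (fun s : R => Rt x (s *: xi)) xi) &
      (* smoothness on TM: locally the restriction of a smooth map *)
      (forall u, tangent_bundle M u ->
         exists (U : set (E * E)) (G : E * E -> E),
           [/\ open U, U u, smooth_on U G &
               forall u', U u' -> tangent_bundle M u' -> G u' = Rt u'.1 u'.2])].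

Definition convex_fun (g : E -> R) : Prop :=
  forall (x y : E) (a : R), 0 <= a <= 1 ->
    g (a *: x + (1 - a) *: y) <= a * g x + (1 - a) * g y.

(** Clarke generalized directional derivative
    F°(x; v) = limsup_{y -> x, t \downarrow 0} (F(y + t v) - F(y)) / t,
    as inf_{delta > 0} sup { ... : |y - x|_F < delta, 0 < t < delta }. *)
Definition clarke_dd (F : E -> R) (x v : E) : \bar R :=
  ereal_inf [set ereal_sup
      [set ((F (u.1 + u.2 *: v) - F u.1) / u.2)%:E | u in
          [set u : E * R | frobn (u.1 - x) < delta /\ 0 < u.2 < delta]]
    | delta in [set d : R | 0 < d]].

(** Clarke generalized subdifferential of F at x (F locally Lipschitz). *)
Definition clarke_subdiff (F : E -> R) (x : E) : set E :=
  [set xi | forall v : E, ((frob xi v)%:E <= clarke_dd F x v)%E].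

End Manifold.

(* Main.v *)
Require Import Defs.
From HB Require Import structures.
From mathcomp Require Import all_boot all_order all_algebra.
From mathcomp Require Import all_classical all_reals all_analysis.
From mathcomp Require Import perm ring lra.
Import Order.TTheory GRing.Theory Num.Theory.
Import numFieldTopology.Exports numFieldNormedType.Exports.
Local Open Scope ring_scope.
Local Open Scope classical_set_scope.

Set Implicit Arguments. Unset Strict Implicit. Unset Printing Implicit Defensive.

(* Along the safeguard iterates z_i the value F decreases by sigma alpha_i |eta_{z_i}|^2
   and stays above F(zs). If |eta| stayed away from 0 near zs, then alpha_i would be
   bounded below: the proximal step satisfies
   <grad f, eta> + g(z + eta) - g(z) <= - <eta, W eta> / mu, the retraction agrees with
   z + s eta to first order uniformly near zs, and F is locally Lipschitz, so the Armijo
   test succeeds for all small s. Hence eta_z is arbitrarily small at points z of M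
   arbitrarily close to zs.

   Every tangent vector v at zs is a limit of tangent vectors at nearby points, because M
   is locally the zero set of a submersion h whose kernels are the tangent spaces (implicit
   functions). Comparing eta_z with such vectors and passing to the limit gives
   phi(v) := <grad f(zs), v> + g(zs + v) - g(zs) >= - C |v|^2 on the tangent space, and
   convexity improves this to phi >= 0 there. Hahn-Banach yields xi orthogonal to the
   tangent space with <xi, .> <= phi; such a xi lies in the Clarke subdifferential, as the
   difference quotients of F based at zs itself already show. *)

(** [W_z] is not assumed to vary continuously with [z], so neither need [eta_z], and the
    minimization problem cannot simply be carried to [zs]. It is used at nearby points, and only
    inequalities pass to the limit: the weights survive through their spectral bounds, and C is
    kappat / (2 mu). The accelerated iterates enter by staying in M and by F(z_{i+1}) <=
    F(R_{z_i}(alpha_i eta_{z_i})), which both branches of the safeguard give.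

    The work lies in the weak form of the data. Tangent vectors are velocities of smooth curves in
    M, so the linearity of a tangent space has to be drawn from the existence of orthogonal
    projections, and a kernel vector of the derivative of [h] becomes tangent only once a smooth
    curve realizes it. Smoothness means continuous iterated directional derivatives; the estimates
    that are uniform in the base point come from the mean value theorem, one direction at a time.
    The ambient topology is that of the max norm, whereas the algorithm measures lengths in the
    Frobenius norm. *)

Lemma cvg_sumr (R : realType) (V : normedModType R) (T I : Type)
    (F : set_system T) {FF : Filter F} (r : seq I) (a : I -> T -> V) (A : I -> V) :
  (forall i, a i @ F --> A i) ->
  \sum_(i <- r) a i x @[x --> F] --> \sum_(i <- r) A i.
Proof.
move=> aA; elim: r => [|i r IH].
  by rewrite big_nil; under eq_cvg do rewrite big_nil; exact: cvg_cst.
rewrite big_cons; under eq_cvg do rewrite big_cons.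
by apply: cvgD; [exact: aA|exact: IH].
Qed.

(** * The Frobenius inner product and its comparison with the max norm *)

Section Frobenius.
Variables (R : realType) (n p : nat).
Local Notation E := 'M[R]_(n, p).
Implicit Types A B C : E.

Lemma frobE A B : frob A B = \sum_i \sum_j A i j * B i j.
Proof.
rewrite /frob /mxtrace exchange_big; apply: eq_bigr => j _.
by rewrite mxE; apply: eq_bigr => i _; rewrite mxE.
Qed.

Lemma frobC A B : frob A B = frob B A.
Proof. by rewrite /frob -mxtrace_tr trmx_mul trmxK. Qed.

Lemma frobDr A B C : frob A (B + C) = frob A B + frob A C.
Proof. by rewrite /frob mulmxDr linearD. Qed.

Lemma frobZr (a : R) A B : frob A (a *: B) = a * frob A B.
Proof. by rewrite /frob -scalemxAr linearZ. Qed.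

Lemma frobNr A B : frob A (- B) = - frob A B.
Proof. by rewrite -scaleN1r frobZr mulN1r. Qed.

Lemma frobBr A B C : frob A (B - C) = frob A B - frob A C.
Proof. by rewrite frobDr frobNr. Qed.

Lemma frobDl A B C : frob (A + B) C = frob A C + frob B C.
Proof. by rewrite frobC frobDr !(frobC C). Qed.

Lemma frobZl (a : R) A B : frob (a *: A) B = a * frob A B.
Proof. by rewrite frobC frobZr frobC. Qed.

Lemma frobNl A B : frob (- A) B = - frob A B.
Proof. by rewrite frobC frobNr frobC. Qed.

Lemma frobBl A B C : frob (A - B) C = frob A C - frob B C.
Proof. by rewrite frobDl frobNl. Qed.

Lemma frob0r A : frob A 0 = 0.
Proof. by rewrite -(scale0r 0) frobZr mul0r. Qed.

Lemma frob0l A : frob 0 A = 0.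
Proof. by rewrite frobC frob0r. Qed.

Lemma frob_ge0 A : 0 <= frob A A.
Proof.
by rewrite frobE; do 2![apply: sumr_ge0 => ? _]; rewrite -expr2 sqr_ge0.
Qed.

Lemma frob_coord_le A i j : A i j ^+ 2 <= frob A A.
Proof.
rewrite frobE (bigD1 i)//= (bigD1 j)//= -expr2 -addrA lerDl addr_ge0//.
  by apply: sumr_ge0 => k _; rewrite -expr2 sqr_ge0.
by do 2![apply: sumr_ge0 => ? _]; rewrite -expr2 sqr_ge0.
Qed.

Lemma frob_eq0 A : frob A A = 0 -> A = 0.
Proof.
move=> A0; apply/matrixP => i j; rewrite mxE; apply/eqP.
by rewrite -sqrf_eq0 eq_le sqr_ge0 andbT -A0 frob_coord_le.
Qed.

Lemma sqr_frobn A : frobn A ^+ 2 = frob A A.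
Proof. by rewrite /frobn sqr_sqrtr// frob_ge0. Qed.

Lemma frobn_ge0 A : 0 <= frobn A.
Proof. exact: sqrtr_ge0. Qed.

Lemma frobnZ (a : R) A : frobn (a *: A) = `|a| * frobn A.
Proof.
by rewrite /frobn frobZl frobZr mulrA -expr2 sqrtrM ?sqr_ge0// sqrtr_sqr.
Qed.

Lemma frob_le_frobn A B : `|frob A B| <= frobn A * frobn B.
Proof.
have sq : frob A B ^+ 2 <= frob A A * frob B B.
  (* Cauchy-Schwarz: with a, b, c as below, this square expands to b (a b - c^2), so b = 0 has to be
     treated apart. *)
  have := frob_ge0 (frob B B *: A - frob A B *: B).
  rewrite !(frobBl, frobBr, frobZl, frobZr) (frobC B A).
  set a := frob A A; set b := frob B B; set c := frob A B => h.
  have [b0|b0] := ltrP 0 b; first by nra.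
  have Bz : B = 0 by apply: frob_eq0; apply/eqP; rewrite eq_le b0 frob_ge0.
  by rewrite /c /b Bz !frob0r expr0n mulr0.
rewrite -(@ler_pXn2r _ 2%N)// ?nnegrE ?mulr_ge0 ?frobn_ge0//.
by rewrite real_normK ?num_real// exprMn !sqr_frobn.
Qed.

Lemma coord_le_norm A i j : `|A i j| <= `|A|.
Proof.
rewrite [leRHS]/Num.Def.normr/= mx_normrE.
exact: (le_bigmax _ (fun ij : 'I_n * 'I_p => `|A ij.1 ij.2|) (i, j)).
Qed.

Lemma norm_le_coord A (r : R) : 0 <= r -> (forall i j, `|A i j| <= r) -> `|A| <= r.
Proof.
move=> r0 Ar; rewrite [leLHS]/Num.Def.normr/= mx_normrE.
by apply: bigmax_le => // -[i j] _; exact: Ar.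
Qed.

Lemma norm_le_frobn A : `|A| <= frobn A.
Proof.
apply: norm_le_coord => [|i j]; first exact: frobn_ge0.
by rewrite -sqrtr_sqr ler_sqrt ?frob_ge0// frob_coord_le.
Qed.

(** A crude substitute for sqrt(n p). The added 1 keeps it positive for empty matrices and makes it
    at most its own square. *)
Definition frob_cst : R := 1 + (n * p)%:R.

Lemma frob_cst_ge1 : 1 <= frob_cst.
Proof. by rewrite lerDl. Qed.

Lemma frob_cst_gt0 : 0 < frob_cst.
Proof. exact: lt_le_trans ltr01 frob_cst_ge1. Qed.

Lemma frobn_le_norm A : frobn A <= frob_cst * `|A|.
Proof.
have c1 := frob_cst_ge1.
rewrite -(@ler_pXn2r _ 2%N)// ?nnegrE ?frobn_ge0//; last first.
  by rewrite mulr_ge0// (le_trans _ c1).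
rewrite sqr_frobn exprMn.
apply: (@le_trans _ _ ((n * p)%:R * `|A| ^+ 2)); last first.
  rewrite ler_wpM2r ?sqr_ge0//; apply: (@le_trans _ _ frob_cst).
    by rewrite lerDr.
  by rewrite expr2 ler_peMl// (le_trans _ c1).
rewrite frobE; apply: (@le_trans _ _ (\sum_(i < n) \sum_(j < p) `|A| ^+ 2)).
  do 2![apply: ler_sum => ? _].
  by rewrite -expr2 -[leLHS]real_normK ?num_real// ler_pXn2r ?nnegrE ?coord_le_norm.
rewrite (eq_bigr (fun=> `|A| ^+ 2 *+ p)); last first.
  by move=> i _; rewrite sumr_const card_ord.
by rewrite sumr_const card_ord -mulrnA mulnC mulr_natl.
Qed.

Lemma cvg_mxP {T : Type} (F : set_system T) {FF : Filter F} (a : T -> E) A :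
  a @ F --> A <-> forall i j, a x i j @[x --> F] --> A i j.
Proof.
split=> [aA i j|aA].
  exact: (cvg_comp _ _ aA (@coord_continuous _ _ _ i j A)).
apply/cvgrPdist_le => e e0; near=> x.
apply: norm_le_coord => [|i j]; first exact: ltW.
rewrite !mxE; move: i j; near: x.
apply: filter_forall => i; apply: filter_forall => j.
by move/cvgrPdist_le: (aA i j); exact.
Unshelve. all: by end_near. Qed.

Lemma cvg_frob {T : Type} (F : set_system T) {FF : Filter F} (a b : T -> E) A B :
  a @ F --> A -> b @ F --> B -> frob (a x) (b x) @[x --> F] --> frob A B.
Proof.
move=> /cvg_mxP aA /cvg_mxP bB; rewrite frobE.
under eq_cvg do rewrite frobE.
by do 2![apply: cvg_sumr => ?]; exact: cvgM.
Qed.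

Lemma cvg_frobn {T : Type} (F : set_system T) {FF : Filter F} (a : T -> E) A :
  a @ F --> A -> frobn (a x) @[x --> F] --> frobn A.
Proof.
move=> aA; have := cvg_comp _ _ (cvg_frob aA aA) (@sqrt_continuous R _).
exact.
Qed.

Lemma frobn_gt0 A : A != 0 -> 0 < frobn A.
Proof.
by move=> A0; rewrite (lt_le_trans _ (norm_le_frobn A))// normr_gt0.
Qed.

End Frobenius.

(** * Strict differentiability from continuous directional derivatives *)

Section DirectionalDerivatives.
Variables (R : realType) (V : normedModType R).
Implicit Types (x v : V) (s : R).

Lemma is_derive_line (W : normedModType R) (f : V -> W) x v s : derivable f (x + s *: v) v ->
  is_derive s 1 (fun r => f (x + r *: v)) ('D_v f (x + s *: v)).
Proof.
have E : (fun h : R => h^-1 *: (((fun r => f (x + r *: v)) \o shift s) (h *: 1) -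
            f (x + s *: v))) =
         (fun h : R => h^-1 *: ((f \o shift (x + s *: v)) (h *: v) - f (x + s *: v))).
  apply/funext => h /=; congr (_ *: (f _ - _)).
  by rewrite [h%:A]mulr1 scalerDl addrCA.
by move=> fd; apply: DeriveDef; rewrite /derivable/derive ?E.
Qed.

(** Writing the segment as [s * a] with [s] in [0, 1] covers both signs of [a] at once. *)
Lemma MVT_line (f : V -> R) x v a :
  (forall s, 0 <= s <= 1 -> derivable f (x + (s * a) *: v) v) ->
  exists2 s, 0 <= s <= 1 & f (x + a *: v) - f x = a * 'D_v f (x + (s * a) *: v).
Proof.
move=> fd; pose h := fun s : R => f (x + (s * a) *: v).
have hd s : 0 <= s <= 1 -> is_derive s 1 h (a * 'D_v f (x + (s * a) *: v)).
  move=> s01.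
  have -> : h = (fun r => f (x + r *: v)) \o ( *%R^~ a) by [].
  have dl := is_derive_line (fd _ s01).
  have da : is_derive s 1 ( *%R^~ a : R -> R) a.
    have -> : *%R^~ a = (a \*: id : R -> R) by apply/funext => r; rewrite /= mulrC.
    by apply: trigger_derive; exact: mulr1.
  have := @is_derive1_comp _ _ ( *%R^~ a) s _ _ dl da.
  by rewrite (mulrC ('D_v f _)).
have [] := @MVT_segment R h (fun s => a * 'D_v f (x + (s * a) *: v)) 0 1 ler01.
- by move=> s /[!in_itv]/= /andP[s0 s1]; apply: hd; rewrite !ltW.
- apply: derivable_within_continuous => s /[!in_itv]/= s01.
  by have [] := hd _ s01.
move=> s /[!in_itv]/= s01 h10; exists s => //.
by move: h10; rewrite /h mul1r mul0r scale0r addr0 subr0 mulr1.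
Qed.

(** The increments are added one direction at a time; the last segment is handled by the mean value
    theorem and the continuity of the directional derivative. The base point [x] may vary near [z],
    and this uniformity is what later uses rely on. *)
Lemma strict_derive m (f : V -> R) (e : 'I_m -> V) (z : V) :
  (forall i, \forall y \near z, derivable f y (e i)) ->
  (forall i, {for z, continuous (fun y => 'D_(e i) f y)}) ->
  forall eps, 0 < eps -> exists2 del, 0 < del &
    forall x (a : 'I_m -> R), `|x - z| < del -> (forall i, `|a i| < del) ->
    `|f (x + \sum_i a i *: e i) - f x - \sum_i a i * 'D_(e i) f z|
      <= eps * \sum_i `|a i|.
Proof.
move=> fd fc eps eps0; elim: m => [|m IH] in e fd fc *.
  exists 1 => // x a _ _; rewrite !big_ord0 addr0 subrr subr0 normr0 mulr0//.
have [d0 d00 Hd0] := IH (e \o widen_ord (leqnSn m)) (fun i => fd _) (fun i => fc _).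
have /nbhs_normP[d1 /= d10 Hd1] : \forall y \near z, derivable f y (e ord_max) /\
    `|'D_(e ord_max) f z - 'D_(e ord_max) f y| <= eps.
  near=> y; split; near: y; first exact: fd.
  by have /cvgrPdist_le/(_ _ eps0) := fc ord_max.
(* Coefficients below d1 / S keep every point of the last segment within (d1 / S) * (1 + sum of the
   [|e i|]) = d1 of [z]. *)
pose S := 1 + \sum_i `|e i|.
have S0 : 0 < S by rewrite ltr_pwDl// sumr_ge0.
exists (Num.min d0 (d1 / S)); first by rewrite lt_min d00 divr_gt0.
move=> x a; rewrite lt_min => /andP[xd0 xd1] ad.
have ad0 i : `|a i| < d0 by have := ad i; rewrite lt_min => /andP[].
have ad1 i : `|a i| < d1 / S by have := ad i; rewrite lt_min => /andP[].
rewrite !big_ord_recr/=.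
have := Hd0 x (a \o widen_ord (leqnSn m)) xd0 (fun i => ad0 _).
set x' := \sum_(i < m) _; set D' := \sum_(i < m) _; set N' := \sum_(i < m) _.
move=> /= Hx'.
have near_seg s : 0 <= s <= 1 -> `|z - (x + x' + (s * a ord_max) *: e ord_max)| < d1.
  move=> /andP[s0 s1]; rewrite distrC (addrAC (x + x')) (addrAC x) -addrA.
  rewrite (le_lt_trans (ler_normD _ _))//.
  apply: (@lt_le_trans _ _ (d1 / S + d1 / S * \sum_i `|e i|)); last first.
    by rewrite -[X in X + _]mulr1 -mulrDr divfK// gt_eqF.
  apply: ltr_leD => //.
  rewrite big_ord_recr/= mulrDr (le_trans (ler_normD _ _))// lerD//.
    rewrite mulr_sumr (le_trans (ler_norm_sum _ _ _))// ler_sum// => i _.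
    by rewrite normrZ ler_wpM2r//; exact/ltW/ad1.
  rewrite normrZ ler_wpM2r// normrM (ger0_norm s0).
  by rewrite (le_trans (ler_piMl _ s1))//; exact/ltW/ad1.
have [s s01 Hs] := @MVT_line f (x + x') (e ord_max) (a ord_max)
   (fun s s01 => (Hd1 _ (near_seg s s01)).1).
have Hd := (Hd1 _ (near_seg s s01)).2.
rewrite addrA.
rewrite [X in `|X|](_ : _ = (f (x + x') - f x - D') +
   a ord_max * ('D_(e ord_max) f (x + x' + (s * a ord_max) *: e ord_max) -
               'D_(e ord_max) f z)); last by rewrite mulrBr -Hs; ring.
rewrite (le_trans (ler_normD _ _))// (mulrDr eps) lerD// normrM mulrC ler_wpM2r//.
by rewrite distrC.
Unshelve. all: by end_near. Qed.

Lemma strict_derive_fin (I : finType) (f : V -> R) (e : I -> V) (z : V) :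
  (forall i, \forall y \near z, derivable f y (e i)) ->
  (forall i, {for z, continuous (fun y => 'D_(e i) f y)}) ->
  forall eps, 0 < eps -> exists2 del, 0 < del &
    forall x (a : I -> R), `|x - z| < del -> (forall i, `|a i| < del) ->
    `|f (x + \sum_i a i *: e i) - f x - \sum_i a i * 'D_(e i) f z|
      <= eps * \sum_i `|a i|.
Proof.
move=> fd fc eps eps0.
have [del del0 H] := @strict_derive _ f (e \o @enum_val I predT) z
  (fun i => fd _) (fun i => fc _) eps eps0.
exists del => // x a xz ad.
have bij := onW_bij predT (@enum_val_bij I).
rewrite !(reindex _ bij)/=.
exact: H x (a \o @enum_val I predT) xz (fun i => ad _).
Qed.

(** The strict estimate at [c s] is applied to the increments [a i (h + s) - a i s = h * q i h]. Its
    error is a small multiple of [|h|] times the sum of the [|q i h|], and the quotients [q i h]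
    stay bounded. *)
Lemma is_derive_comp_sum (I : finType) (f : V -> R) (e : I -> V) (c0 : V)
    (c : R -> V) (a : I -> R -> R) (d : I -> R) (s : R) :
  (forall i, \forall y \near c s, derivable f y (e i)) ->
  (forall i, {for c s, continuous (fun y => 'D_(e i) f y)}) ->
  (\forall r \near s, c r = c0 + \sum_i a i r *: e i) ->
  (forall i, is_derive s 1 (a i) (d i)) ->
  is_derive s 1 (f \o c) (\sum_i d i * 'D_(e i) f (c s)).
Proof.
move=> fd fc cE ad.
pose D := \sum_i d i * 'D_(e i) f (c s).
pose q i h := h^-1 * (a i (h + s) - a i s).
have qd i : q i h @[h --> 0^'] --> d i.
  have [/cvg_ex[l Hl] <-] := ad i.
  rewrite (_ : 'D_1 (a i) s = l); last exact: cvg_lim Hl.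
  apply: cvg_trans Hl; apply: near_eq_cvg; near=> h.
  by rewrite /q /= [h%:A]mulr1.
suff H : h^-1 *: ((f \o c \o shift s) (h *: 1) - (f \o c) s) @[h --> 0^'] --> D.
  by apply: DeriveDef; [apply/cvg_ex; exists D|exact: cvg_lim H].
pose B := 1 + \sum_i (`|d i| + 1).
have B0 : 0 < B by rewrite ltr_pwDl// sumr_ge0// => i _; rewrite addr_ge0.
have QD : \sum_i q i h * 'D_(e i) f (c s) @[h --> 0^'] --> D.
  by apply: cvg_sumr => i; apply: cvgM; [exact: qd|exact: cvg_cst].
apply/cvgrPdist_le => eps eps0.
have eps1 : 0 < eps / 2 / B by rewrite !divr_gt0.
have [del del0 H] := strict_derive_fin fd fc eps1.
have shift0 (P : set R) : nbhs s P -> \forall h \near 0^', P (h + s).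
  move=> Ps; apply: nbhs_dnbhs; have /nbhs0P := Ps.
  by apply: filterS => h; rewrite addrC.
near=> h.
have h0 : h != 0 by near: h; exact: nbhs_dnbhs_neq.
have csE : c s = c0 + \sum_i a i s *: e i by exact: nbhs_singleton cE.
have chE : c (h + s) = c s + \sum_i (a i (h + s) - a i s) *: e i.
  rewrite csE -addrA -big_split/=; under [in RHS]eq_bigr do rewrite -scalerDl addrC subrK.
  by near: h; exact: shift0 cE.
have qB i : `|q i h| <= `|d i| + 1.
  move: i; near: h; apply: filter_forall => i.
  have /cvgrPdist_le/(_ 1 ltr01) := qd i; apply: filterS => h.
  move=> H1; rewrite -[q i h](subrK (d i)) addrC (le_trans (ler_normD _ _))// lerD2l.
  by rewrite distrC.
have ah i : a i (h + s) - a i s = h * q i h by rewrite /q mulVKf.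
have small i : `|a i (h + s) - a i s| < del.
  rewrite ah normrM (@le_lt_trans _ _ (`|h| * B))//.
    rewrite ler_wpM2l// (le_trans (qB i))// /B (bigD1 i)//=.
    by rewrite addrCA lerDl addr_ge0// sumr_ge0// => j _; rewrite addr_ge0.
  rewrite -ltr_pdivlMr//; near: h; apply: dnbhs0_lt; exact: divr_gt0.
have := H (c s) (fun i => a i (h + s) - a i s); rewrite subrr normr0.
move=> /(_ del0 small); rewrite -chE => Hh.
rewrite /= [h%:A]mulr1 -[D](subrK (\sum_i q i h * 'D_(e i) f (c s))) -addrA.
rewrite (splitr eps) (le_trans (ler_normD _ _))// lerD//.
  by near: h; move/cvgrPdist_le : QD; apply; rewrite divr_gt0.
rewrite -(ler_pM2l (x := `|h|)) ?normr_gt0// -normrM mulrBr mulr_sumr.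
rewrite [h * _](mulVKf h0).
rewrite distrC [X in `|_ - X|](_ : _ = \sum_i (a i (h + s) - a i s) * 'D_(e i) f (c s)); last first.
  by apply: eq_bigr => i _; rewrite mulrA ah.
apply: (le_trans Hh).
rewrite (eq_bigr (fun i => `|h| * `|q i h|)); last by move=> i _; rewrite ah normrM.
have BN0 : B != 0 by rewrite gt_eqF.
rewrite -mulr_sumr mulrCA ler_wpM2l// -[leRHS](divfK BN0) (ler_wpM2l (ltW eps1))//.
apply: (@le_trans _ _ (\sum_i (`|d i| + 1))); last by rewrite lerDr.
by apply: ler_sum => i _; exact: qB.
Unshelve. all: by end_near. Qed.

(** Additivity in the direction is the chain rule along a straight line; it rests on the continuity
    of the derivatives along the [e i]. *)
Lemma derive_sum_dir (I : finType) (f : V -> R) (e : I -> V) (z : V) (a : I -> R) :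
  (forall i, \forall y \near z, derivable f y (e i)) ->
  (forall i, {for z, continuous (fun y => 'D_(e i) f y)}) ->
  is_derive z (\sum_i a i *: e i) f (\sum_i a i * 'D_(e i) f z).
Proof.
move=> fd fc.
have cE r : z + r *: (\sum_i a i *: e i) = z + \sum_i (r * a i) *: e i.
  by rewrite scaler_sumr; under eq_bigr do rewrite scalerA.
have z0 : z + 0 *: (\sum_i a i *: e i) = z by rewrite scale0r addr0.
have := @is_derive_comp_sum _ f e z (fun r => z + r *: (\sum_i a i *: e i))
  (fun i => a i \*o id) a 0.
rewrite z0 => /(_ fd fc).
have H1 : \forall r \near 0, z + r *: (\sum_i a i *: e i) =
          z + \sum_i (a i \*o id) r *: e i.
  by near=> r; rewrite cE; congr (_ + _); apply: eq_bigr => i _ /=; rewrite mulrC.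
move=> /(_ H1).
have H2 i : is_derive (0 : R) (1 : R) (a i \*o id : R -> R) (a i).
  have -> : (a i \*o id : R -> R) = (a i \*: id : R -> R) by [].
  by apply: trigger_derive; exact: mulr1.
move=> /(_ H2)[].
have E : (fun h : R => h^-1 *: ((f \o shift z) (h *: (\sum_i a i *: e i)) - f z)) =
   (fun h : R => h^-1 *: (((f \o (fun r => z + r *: (\sum_i a i *: e i))) \o shift 0) (h *: 1) -
            (f \o (fun r => z + r *: (\sum_i a i *: e i))) 0)).
  by apply/funext => h /=; rewrite [h%:A]mulr1 addr0 z0 [h *: _ + z]addrC.
by move=> h1 h2; apply: DeriveDef; rewrite /derivable /derive E.
Unshelve. all: by end_near. Qed.

End DirectionalDerivatives.

(** * Functions of class C^m on an open set *)

Section SmoothFunctions.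
Variables (R : realType) (V : normedModType R).
Implicit Types (U : set V) (f g : V -> R).

(* Class C^m on U, phrased with directional derivatives only. *)
Fixpoint Cn U (m : nat) f : Prop :=
  (forall x, U x -> {for x, continuous f}) /\
  if m is m'.+1 then
    forall v, (forall x, U x -> derivable f x v) /\ Cn U m' (fun x => 'D_v f x)
  else True.

Lemma Cn_continuous U m f x : U x -> Cn U m f -> {for x, continuous f}.
Proof. by case: m => [|m] Ux [fc _]; exact: fc. Qed.

Lemma Cn_derivable U m f v x : U x -> Cn U m.+1 f -> derivable f x v.
Proof. by move=> Ux [_ /(_ v)[fd _]]; exact: fd. Qed.

Lemma Cn_derive U m f v : Cn U m.+1 f -> Cn U m (fun x => 'D_v f x).
Proof. by move=> [_ /(_ v)[]]. Qed.

Lemma CnW U m f : Cn U m.+1 f -> Cn U m f.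
Proof.
elim: m f => [|m IH] f [fc fd]; split => // v.
by have [fdv fv] := fd v; split=> //; exact: IH.
Qed.

Lemma Cn_subset U U' m f : U' `<=` U -> Cn U m f -> Cn U' m f.
Proof.
move=> UU'; elim: m f => [|m IH] f [fc fd]; split => //.
- by move=> x /UU'; exact: fc.
- by move=> x /UU'; exact: fc.
- move=> v; have [fdv fv] := fd v; split; last exact: IH.
  by move=> x /UU'; exact: fdv.
Qed.

Variable U : set V.
Hypothesis oU : open U.

Lemma near_open_eq f g x : (forall y, U y -> f y = g y) -> U x -> {near x, f =1 g}.
Proof.
move=> fg Ux; have := open_nbhs_nbhs (conj oU Ux).
by apply: filterS => y Uy; exact: fg.
Qed.

Lemma continuous_open_eq f g x : (forall y, U y -> f y = g y) -> U x ->
  {for x, continuous f} -> {for x, continuous g}.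
Proof.
move=> fg Ux fc; change (g @ x --> g x); rewrite -(fg x Ux).
by apply: cvg_trans fc; exact: near_eq_cvg (near_open_eq fg Ux).
Qed.

Lemma Cn_ext m f g : (forall x, U x -> f x = g x) -> Cn U m f -> Cn U m g.
Proof.
elim: m f g => [|m IH] f g fg [fc fd].
  by split=> // x Ux; exact: continuous_open_eq fg Ux (fc _ Ux).
split=> [x Ux|v]; first exact: continuous_open_eq fg Ux (fc _ Ux).
have [fdv fv] := fd v; split=> [x Ux|].
  exact: near_eq_derivable (near_open_eq fg Ux) (fdv _ Ux).
apply: IH fv => x Ux; exact/near_eq_derive/near_open_eq.
Qed.

Lemma Cn_cst m (a : R) : Cn U m (cst a).
Proof.
elim: m a => [|m IH] a; split=> //; try by move=> x _; exact: cvg_cst.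
move=> v; split=> [x _|]; first exact: derivable_cst.
by apply: Cn_ext (IH 0) => x _; rewrite /= derive_cst.
Qed.

Lemma CnD m f g : Cn U m f -> Cn U m g -> Cn U m (f \+ g).
Proof.
elim: m f g => [|m IH] f g Cf Cg.
  by split=> // x Ux; apply: cvgD; [exact: Cn_continuous Ux Cf|exact: Cn_continuous Ux Cg].
split=> [x Ux|v]; first by apply: cvgD; [exact: Cn_continuous Ux Cf|exact: Cn_continuous Ux Cg].
split=> [x Ux|]; first by apply: derivableD; [exact: Cn_derivable Ux Cf|exact: Cn_derivable Ux Cg].
apply: Cn_ext (IH _ _ (Cn_derive v Cf) (Cn_derive v Cg)) => x Ux /=.
by rewrite [RHS]deriveD//; [exact: Cn_derivable Ux Cf|exact: Cn_derivable Ux Cg].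
Qed.

Lemma CnM m f g : Cn U m f -> Cn U m g -> Cn U m (f \* g).
Proof.
elim: m f g => [|m IH] f g Cf Cg.
  by split=> // x Ux; apply: cvgM; [exact: Cn_continuous Ux Cf|exact: Cn_continuous Ux Cg].
split=> [x Ux|v]; first by apply: cvgM; [exact: Cn_continuous Ux Cf|exact: Cn_continuous Ux Cg].
split=> [x Ux|]; first by apply: derivableM; [exact: Cn_derivable Ux Cf|exact: Cn_derivable Ux Cg].
have C1 := CnD (IH _ _ (CnW Cf) (Cn_derive v Cg)) (IH _ _ (CnW Cg) (Cn_derive v Cf)).
apply: Cn_ext C1 => x Ux /=.
by rewrite [RHS]deriveM//; [exact: Cn_derivable Ux Cf|exact: Cn_derivable Ux Cg].
Qed.

Lemma CnV m f : (forall x, U x -> f x != 0) -> Cn U m f ->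
  Cn U m (fun x => (f x)^-1).
Proof.
move=> f0; elim: m => [|m IH] Cf.
  by split=> // x Ux; apply: cvgV; [exact: f0|exact: Cn_continuous Ux Cf].
split=> [x Ux|v]; first by apply: cvgV; [exact: f0|exact: Cn_continuous Ux Cf].
split=> [x Ux|]; first by apply: derivableV; [exact: f0|exact: Cn_derivable Ux Cf].
have If := IH (CnW Cf).
have C1 := CnM (CnM (Cn_cst m (-1)) (CnM If If)) (Cn_derive v Cf).
apply: Cn_ext C1 => x Ux /=.
rewrite [RHS]deriveV//; [|exact: f0|exact: Cn_derivable Ux Cf].
by rewrite mulN1r -invfM -expr2.
Qed.

Lemma Cn_sum (I : Type) (r : seq I) (P : pred I) m (f : I -> V -> R) :
  (forall i, Cn U m (f i)) -> Cn U m (fun x => \sum_(i <- r | P i) f i x).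
Proof.
move=> Cf; elim: r => [|i r IH].
  by apply: Cn_ext (Cn_cst m 0) => x _; rewrite big_nil.
have [Pi|Pi] := boolP (P i).
  by apply: Cn_ext (CnD (Cf i) IH) => x _; rewrite big_cons Pi.
by apply: Cn_ext IH => x _; rewrite big_cons (negbTE Pi).
Qed.

Lemma Cn_prod (I : Type) (r : seq I) m (f : I -> V -> R) :
  (forall i, Cn U m (f i)) -> Cn U m (fun x => \prod_(i <- r) f i x).
Proof.
move=> Cf; elim: r => [|i r IH].
  by apply: Cn_ext (Cn_cst m 1) => x _; rewrite big_nil.
by apply: Cn_ext (CnM (Cf i) IH) => x _; rewrite big_cons.
Qed.

Lemma Cn_det k m (A : V -> 'M[R]_k) :
  (forall i j, Cn U m (fun x => A x i j)) -> Cn U m (fun x => \det (A x)).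
Proof.
move=> CA; rewrite /determinant; apply: Cn_sum => s.
have Cp := @Cn_prod _ (index_enum _) m (fun i x => A x i ((s : 'S_k) i)) (fun i => CA _ _).
exact: CnM (Cn_cst m ((-1) ^+ s)) Cp.
Qed.

(** Cramer's formula: cofactors and the determinant are polynomials in the entries. *)
Lemma Cn_invmx k m (A : V -> 'M[R]_k) :
  (forall x, U x -> A x \in unitmx) ->
  (forall i j, Cn U m (fun x => A x i j)) ->
  forall i j, Cn U m (fun x => invmx (A x) i j).
Proof.
move=> uA CA i j.
have Cc : Cn U m (fun x => cofactor (A x) j i).
  have Cr : Cn U m (fun x => \det (row' j (col' i (A x)))).
    apply: (@Cn_det _ _ (fun x => row' j (col' i (A x)))) => a b.
    by apply: Cn_ext (CA (lift j a) (lift i b)) => x _; rewrite !mxE.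
  exact: CnM (Cn_cst m ((-1) ^+ (j + i))) Cr.
have Cd : Cn U m (fun x => (\det (A x))^-1).
  by apply: CnV; [move=> x /uA; rewrite unitmxE unitfE|exact: Cn_det].
apply: Cn_ext (CnM Cd Cc) => x Ux /=.
by rewrite /invmx uA// !mxE.
Qed.

(** [iter_derive] takes the derivative along the last vector of the list first. Peeling off that
    innermost derivative gives the recursion followed by [Cn]. *)
Lemma smooth_onP (W : normedModType R) (f : V -> W) :
  smooth_on U f <->
  [/\ forall x, U x -> {for x, continuous f},
      forall v x, U x -> derivable f x v &
      forall v, smooth_on U (fun x => 'D_v f x)].
Proof.
have iterE vs v : iter_derive (rcons vs v) f = iter_derive vs (fun x => 'D_v f x).
  by elim: vs => //= w vs ->.
split=> [sf|[fc fd sf]].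
  split=> [x Ux|v x Ux|v].
  - exact: (sf [::] x Ux).1.
  - exact: (sf [::] x Ux).2.
  - by move=> vs x Ux; rewrite -iterE; exact: sf.
move=> vs x Ux; case/lastP: vs => [|vs v].
  by split=> [|v]; [exact: fc|exact: fd].
by rewrite iterE; exact: sf.
Qed.

Lemma smooth_on_coord a b (f : V -> 'M[R]_(a, b)) i j m :
  smooth_on U f -> Cn U m (fun x => f x i j).
Proof.
have fij (g : V -> 'M[R]_(a, b)) x : {for x, continuous g} ->
    {for x, continuous (fun x => g x i j)}.
  by move=> gc; exact: (cvg_comp _ _ gc (@coord_continuous _ _ _ i j (g x))).
elim: m f => [|m IH] f /smooth_onP[fc fd sf].
  by split=> // x Ux; exact/fij/fc.
split=> [x Ux|v]; first exact/fij/fc.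
split=> [x Ux|]; first by have /derivable_mxP := fd v x Ux; exact.
by apply: Cn_ext (IH _ (sf v)) => x Ux; rewrite derive_mx ?mxE//; exact: fd.
Qed.

Lemma coord_smooth_on a b (f : V -> 'M[R]_(a, b)) :
  (forall i j m, Cn U m (fun x => f x i j)) -> smooth_on U f.
Proof.
move=> Cf vs; have [k] := ubnP (size vs); elim: k vs f Cf => // k IH vs f Cf.
have fc x : U x -> {for x, continuous f}.
  by move=> Ux; apply/cvg_mxP => i j; exact: (Cn_continuous Ux (Cf i j 0%N)).
have fd v x : U x -> derivable f x v.
  by move=> Ux; apply/derivable_mxP => i j; exact: (Cn_derivable Ux (Cf i j 1%N)).
case/lastP: vs => [|vs v]; first by move=> _ x Ux; split=> [|v]; [exact: fc|exact: fd].
rewrite size_rcons ltnS => vk x Ux.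
have -> : iter_derive (rcons vs v) f = iter_derive vs (fun x => 'D_v f x).
  by elim: vs {vk} => //= w vs ->.
apply: IH => // i j m; apply: Cn_ext (Cn_derive v (Cf i j m.+1)) => y Uy.
by rewrite derive_mx ?mxE//; exact: fd.
Qed.

End SmoothFunctions.

Section Curves.
Variables (R : realType) (V : normedModType R).

(** [Cn] on the real line asks for derivatives along every real [w], while the chain rule delivers
    the direction 1. *)
Lemma derive_scale_dir (f : R -> R) (s w d : R) :
  is_derive s 1 f d -> is_derive s w f (w * d).
Proof.
move=> [fd <-]; have df : differentiable f s by apply/derivable1_diffP.
apply: DeriveDef; first exact: diff_derivable.
by rewrite !deriveE// -[w in LHS]mulr1 [LHS]linearZ.
Qed.

(** Bootstrap for an autonomous differential equation: the derivative of [f \o c] is again a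
    function of class C^q composed with [c], so induction on [q], for all [f] at once, climbs one
    order at a time. *)
Lemma Cn_curve (I : finType) (U : set V) (J : set R) (e : I -> V) (c0 : V)
    (c : R -> V) (a : I -> R -> R) (d : I -> V -> R) :
  open U -> open J -> (forall s, J s -> U (c s)) ->
  (forall s, J s -> {for s, continuous c}) ->
  (forall s, J s -> c s = c0 + \sum_i a i s *: e i) ->
  (forall i s, J s -> is_derive s 1 (a i) (d i (c s))) ->
  (forall i q, Cn U q (d i)) ->
  forall q f, Cn U q f -> Cn J q (f \o c).
Proof.
move=> oU oJ cU cc cE ad Cd; elim=> [|q IH] f Cf.
  split=> // s Js; apply: continuous_comp; first exact: cc.
  exact: Cn_continuous (cU _ Js) Cf.
split=> [s Js|v].
  by apply: continuous_comp; [exact: cc|exact: Cn_continuous (cU _ Js) Cf].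
have dfc s : J s -> is_derive s v (f \o c) (v * \sum_i d i (c s) * 'D_(e i) f (c s)).
  move=> Js; apply: derive_scale_dir.
  apply: (@is_derive_comp_sum _ _ _ _ _ c0 _ a).
  - move=> i; have := open_nbhs_nbhs (conj oU (cU _ Js)).
    by apply: filterS => y Uy; exact: Cn_derivable Uy Cf.
  - by move=> i; exact: Cn_continuous (cU _ Js) (Cn_derive _ Cf).
  - by have := open_nbhs_nbhs (conj oJ Js); apply: filterS => r; exact: cE.
  - by move=> i; exact: ad.
split=> [s Js|]; first by have [] := dfc s Js.
have C1 : Cn U q (fun x => v * \sum_i d i x * 'D_(e i) f x).
  apply: (CnM oU (Cn_cst oU q v)); apply: Cn_sum => // i.
  by apply: CnM => //; exact: Cn_derive.
by apply: Cn_ext (IH _ C1) => // s Js; have [_ ->] := dfc s Js.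
Qed.

End Curves.

Lemma is_derive_coord (R : realType) n p (x v : 'M[R]_(n, p)) i j :
  is_derive x v (fun x : 'M[R]_(n, p) => x i j) (v i j).
Proof.
have /derivable_mxP dx := @derivable_id _ _ x v.
apply: DeriveDef; first exact: dx.
have := @derive_mx _ _ _ _ id x v (@derivable_id _ _ x v).
by rewrite derive_id => {2}->; rewrite mxE.
Qed.

Lemma Cn_coord (R : realType) n p (U : set 'M[R]_(n, p)) i j m :
  open U -> Cn U m (fun x : 'M[R]_(n, p) => x i j).
Proof.
move=> oU; case: m => [|m]; split=> //; try by move=> x _; exact: coord_continuous.
move=> v; split=> [x _|]; first by have [] := is_derive_coord x v i j.
by apply: Cn_ext (Cn_cst oU m (v i j)) => // x _; have [_ ->] := is_derive_coord x v i j.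
Qed.

(** * Level sets of submersions and tangent spaces *)

Section CompleteRows.
Variables (R : realType) (k : nat).
HB.instance Definition _ :=
  Uniform_isComplete.Build 'rV[R]_k (@mx_complete R 1 k).

Lemma half_contraction_fixpoint (r : R) (T : 'rV[R]_k -> 'rV[R]_k) : 0 <= r ->
  (forall u, `|u| <= r -> `|T u| <= r) ->
  (forall u v, `|u| <= r -> `|v| <= r -> `|T u - T v| <= 2^-1 * `|u - v|) ->
  exists2 u, `|u| <= r & T u = u.
Proof.
move=> r0 Tr Tc; pose B := [set u : 'rV[R]_k | `|u| <= r].
have Tf : {homo T : x / B x >-> B x} by move=> u; exact: Tr.
have clB : closed B.
  have -> : B = Num.norm @^-1` [set x : R | x <= r] by [].
  apply: closed_comp; last exact: closed_le.
  by move=> u _; exact: norm_continuous.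
have ctr : is_contraction (mkfun_fun Tf).
  exists 2^-1%:nng; split; first by rewrite /= invf_lt1// ltr1n.
  by move=> -[u v] [/= Bu Bv]; exact: Tc.
have [|u Bu uE] := banach_fixed_point ctr clB.
  by exists 0; rewrite /B /= normr0.
by exists u.
Qed.

End CompleteRows.

Lemma common_radius (R : realType) (I : finType) (P : I -> R -> Prop) :
  (forall i d d', d' <= d -> P i d -> P i d') ->
  (forall i, exists2 d, 0 < d & P i d) ->
  exists2 d, 0 < d & forall i, P i d.
Proof.
move=> Pmono Pex.
have /choice[del delP] : forall i, exists d, 0 < d /\ P i d.
  by move=> i; have [d] := Pex i; exists d.
exists (\big[Num.min/1]_i del i).
  elim/big_ind: _ => // [x y x0 y0|i _]; first by rewrite lt_min x0.
  by have [] := delP i.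
move=> i; apply: (Pmono i (del i)); last by have [] := delP i.
exact: bigmin_le.
Qed.

Section LocalChart.
Variables (R : realType) (n p k : nat).
Local Notation E := 'M[R]_(n, p).
Variables (U : set E) (h : E -> 'rV[R]_k) (z : E) (b : 'I_k -> E).
Hypotheses (oU : open U) (sh : smooth_on U h) (Uz : U z).
Hypothesis hb : forall i, 'D_(b i) h z = delta_mx 0 i.

Let hl l y : R := h y 0 l.
Let dh v y : 'rV[R]_k := \row_l 'D_v (hl l) y.
(** The derivative of [h] on the span of the [b i]. It is the identity at [z], hence invertible
    nearby, where the span is thus transverse to the kernel of the derivative. *)
Let J y : 'M[R]_k := \matrix_(i, l) 'D_(b i) (hl l) y.

Let Ch l m : Cn U m (hl l).
Proof. exact: smooth_on_coord. Qed.

Let Cdh v l m : Cn U m (fun y => 'D_v (hl l) y).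
Proof. by apply: Cn_derive; exact: (Ch l m.+1). Qed.

Let dhE v y : U y -> 'D_v h y = dh v y.
Proof.
move=> Uy; rewrite derive_mx; last by have [_ + _] := (smooth_onP U h).1 sh; exact.
by apply/matrixP => i l; rewrite ord1 !mxE.
Qed.

Let J_z : J z = 1%:M.
Proof.
apply/matrixP => i l; rewrite !mxE.
have := hb i; rewrite dhE// => /matrixP/(_ 0 l); rewrite !mxE => ->.
by rewrite eqxx eq_sym.
Qed.

Let near_derivable l v y : U y -> \forall y' \near y, derivable (hl l) y' v.
Proof.
move=> Uy; have := open_nbhs_nbhs (conj oU Uy).
by apply: filterS => y' Uy'; exact: Cn_derivable Uy' (Ch l 1).
Qed.

Let cont_dh l v y : U y -> {for y, continuous (fun y => 'D_v (hl l) y)}.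
Proof. by move=> Uy; exact: Cn_continuous Uy (Cdh v l 0). Qed.

Let dh_sum (I : finType) (e : I -> E) (a : I -> R) y : U y ->
  dh (\sum_i a i *: e i) y = \sum_i a i *: dh (e i) y.
Proof.
move=> Uy; apply/matrixP => i l; rewrite ord1 summxE !mxE.
have [_ ->] := @derive_sum_dir R E I (hl l) e y a
  (fun i => near_derivable l _ Uy) (fun i => @cont_dh l _ y Uy).
by apply: eq_bigr => j _; rewrite !mxE.
Qed.

Let strict_h (I : finType) (e : I -> E) (y : E) eps : U y -> 0 < eps ->
  exists2 del, 0 < del & forall x (a : I -> R), `|x - y| < del ->
    (forall i, `|a i| < del) ->
    `|h (x + \sum_i a i *: e i) - h x - \sum_i a i *: dh (e i) y|
      <= eps * \sum_i `|a i|.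
Proof.
move=> Uy eps0.
have [|l|del del0 H] := @common_radius R 'I_k (fun l del =>
   forall x (a : I -> R), `|x - y| < del -> (forall i, `|a i| < del) ->
    `|hl l (x + \sum_i a i *: e i) - hl l x - \sum_i a i * 'D_(e i) (hl l) y|
      <= eps * \sum_i `|a i|).
- move=> l d d' d'd H x a xd ad; apply: H; first exact: lt_le_trans d'd.
  by move=> i; apply: lt_le_trans d'd.
- apply: strict_derive_fin => // i; first exact: near_derivable.
  exact: cont_dh.
exists del => // x a xd ad; apply: norm_le_coord.
  by apply: mulr_ge0; [exact: ltW|exact: sumr_ge0].
move=> i l; rewrite ord1; have := H l x a xd ad.
rewrite !mxE summxE; congr (`|_ - _| <= _).
by apply: eq_bigr => j _; rewrite !mxE.
Qed.

Lemma chart_radius : exists2 rho, 0 < rho &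
  ball z rho `<=` U /\ forall y, ball z rho y -> J y \in unitmx.
Proof.
have cdet : {for z, continuous (fun y => \det (J y))}.
  apply: (Cn_continuous Uz (m := 0)); apply: Cn_det => // i l.
  by apply: Cn_ext (Cdh (b i) l 0) => // y _; rewrite mxE.
have dn : \forall y \near z, \det (J y) != 0.
  by apply: (cvgr_neq0 (\det (J z)) cdet); rewrite J_z det1 oner_neq0.
have : \forall y \near z, U y /\ J y \in unitmx.
  near=> y; split; first by near: y; exact: open_nbhs_nbhs (conj oU Uz).
  by rewrite unitmxE unitfE; near: y.
move=> /nbhs_ballP[rho /= rho0 H]; exists rho => //.
by split=> y /H[].
Unshelve. all: by end_near. Qed.

(** The correction of [v]: where [J y] is invertible, the derivative of [h] at [y] vanishes on
    [v - \sum_i kap v y 0 i *: b i]. Up to sign these are also the derivatives of the implicit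
    functions. *)
Let kap v y : 'rV[R]_k := dh v y *m invmx (J y).

Let Ckap rho v i m : ball z rho `<=` U -> (forall y, ball z rho y -> J y \in unitmx) ->
  Cn (ball z rho) m (fun y => kap v y 0 i).
Proof.
move=> rhoU uJ; have ob : open (ball z rho) by exact: ball_open.
have CJ i' l : Cn (ball z rho) m (fun y => J y i' l).
  by apply: Cn_ext (Cn_subset rhoU (Cdh (b i') l m)) => // y _; rewrite mxE.
have CV := Cn_invmx ob uJ CJ.
have := @Cn_sum _ _ _ ob _ (index_enum _) xpredT m
  (fun l y => dh v y 0 l * invmx (J y) l i).
have Cl l : Cn (ball z rho) m (fun y => dh v y 0 l * invmx (J y) l i).
  apply: CnM => //.
  by apply: Cn_ext (Cn_subset rhoU (Cdh v l m)) => // y _; rewrite mxE.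
by move=> /(_ Cl); apply: Cn_ext => // y _; rewrite mxE.
Qed.

Let dh_lin v a w y : U y -> dh (v + a *: w) y = dh v y + a *: dh w y.
Proof.
move=> Uy; have := @dh_sum bool (fun c => if c then v else w)
  (fun c => if c then 1 else a) y Uy.
by rewrite !big_bool !scale1r.
Qed.

Let sum_row (u : 'rV[R]_k) y : \sum_i u 0 i *: dh (b i) y = u *m J y.
Proof.
apply/matrixP => i l; rewrite ord1 summxE mxE; apply: eq_bigr => j _.
by rewrite !mxE.
Qed.

(** [kap v] is continuous and vanishes at [z], so the correction of [v] is small near [z]. *)
Lemma kernel_lower_semicontinuous v : 'D_v h z = 0 -> forall eps, 0 < eps ->
  \forall y \near z, exists2 v', `|v - v'| < eps & 'D_v' h y = 0.
Proof.
move=> vz eps eps0; have [rho rho0 [rhoU uJ]] := chart_radius.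
have zz : ball z rho z by exact: ballxx.
have kz : kap v z = 0 by rewrite /kap -dhE// vz mul0mx.
have kc : \sum_i kap v y 0 i *: b i @[y --> z] --> \sum_i kap v z 0 i *: b i.
  apply: (@cvg_sumr _ _ _ _ (nbhs z) (nbhs_filter z)) => i; apply: cvgZ; last exact: cvg_cst.
  exact: Cn_continuous zz (Ckap v i 0 rhoU uJ).
have kn : \forall y \near z, `|\sum_i kap v y 0 i *: b i| < eps.
  move/cvgrPdist_lt/(_ _ eps0): kc; apply: filterS => y.
  by rewrite kz big1 ?sub0r ?normrN// => i _; rewrite mxE scale0r.
near=> y.
have By : ball z rho y by near: y; exact: nbhsx_ballx.
exists (v - \sum_i kap v y 0 i *: b i).
  by rewrite opprB addrC subrK; near: y.
have Uy := rhoU _ By.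
rewrite dhE// -scaleN1r dh_lin// dh_sum// sum_row /kap mulmxKV ?uJ//.
by rewrite scaleN1r subrr.
Unshelve. all: by end_near. Qed.

Let strict_chart w y eps : U y -> 0 < eps ->
  exists2 del, 0 < del & forall x s (u : 'rV[R]_k), `|x - y| < del ->
    `|s| < del -> `|u| < del ->
    `|h (x + (s *: w + \sum_i u 0 i *: b i)) - h x - (s *: dh w y + u *m J y)|
      <= eps * (`|s| + k%:R * `|u|).
Proof.
move=> Uy eps0.
have sumE (V : nmodType) (F : option 'I_k -> V) :
    \sum_(o < k.+1) F (unlift ord0 o) = F None + \sum_(i < k) F (Some i).
  by rewrite big_ord_recl unlift_none; under eq_bigr do rewrite liftK.
(* Index [ord0] stands for the direction [w], the others for the [b i]. *)
have [del del0 H] := @strict_h 'I_k.+1 (fun o => oapp b w (unlift ord0 o)) y eps Uy eps0.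
exists del => // x s u xd sd ud.
have ui i : `|u 0 i| < del by apply: le_lt_trans ud; exact: coord_le_norm.
have := H x (fun o => oapp (u 0) s (unlift ord0 o)) xd.
have ad o : `|oapp (u 0) s (unlift ord0 o)| < del by case: (unlift ord0 o).
move=> /(_ ad).
rewrite (sumE _ (fun o => oapp (u 0) s o *: oapp b w o)).
rewrite (sumE _ (fun o => oapp (u 0) s o *: dh (oapp b w o) y)).
rewrite (sumE _ (fun o => `|oapp (u 0) s o|)) /= sum_row => /le_trans; apply.
rewrite (ler_wpM2l (ltW eps0))// lerD2l.
apply: (@le_trans _ _ (\sum_(i < k) `|u|)).
  by apply: ler_sum => i _; exact: coord_le_norm.
by rewrite sumr_const card_ord mulr_natl.
Qed.

(* For small s, u s is the fixed point of u |-> u - h (z + s w + sum_i u_i b_i), a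
   contraction because the derivative of h along the b_i is the identity at z. *)
Lemma implicit_curve w : h z = 0 -> 'D_w h z = 0 ->
  exists r : R, exists u : R -> 'rV[R]_k, exists rho : R,
  [/\ 0 < r, 0 < rho /\ ball z rho `<=` U,
   forall y, ball z rho y -> J y \in unitmx,
   u 0 = 0 &
   forall s, `|s| < r -> 
     let c s := z + (s *: w + \sum_i u s 0 i *: b i) in
     [/\ ball z rho (c s), h (c s) = 0 &
         forall i, is_derive s (1 : R) (fun s => u s 0 i) (- kap w (c s) 0 i)]].
Proof.
move=> hz wz; have [rho rho0 [rhoU uJ]] := chart_radius.
have k1 : 0 < 1 + k%:R :> R by rewrite ltr_pwDl.
(* Chosen so that eps (|s| + k |u|) <= (|s| + |u|) / 2, the source of the contraction factor. *)
have eps0 : 0 < (2 * (1 + k%:R))^-1 :> R by rewrite invr_gt0 mulr_gt0.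
have [del del0 Hst] := strict_chart w Uz eps0.
pose S := `|w| + \sum_i `|b i|.
have S0 : 0 <= S by rewrite addr_ge0// sumr_ge0.
pose d := Num.min del rho.
have d0 : 0 < d by rewrite lt_min del0.
have d_del : d <= del by rewrite ge_min lexx.
have d_rho : d <= rho by rewrite ge_min lexx orbT.
(* Parameters bounded by [r] keep [c s u] within [d] of [z], and the difference of two of them stays
   below [del]. *)
pose r := d / (3 * (1 + S)).
have S1 : 0 < 3 * (1 + S) by rewrite mulr_gt0// ltr_pwDl.
have r0 : 0 < r by rewrite divr_gt0.
have rE : r * (3 * (1 + S)) = d by rewrite divfK// gt_eqF.
have rS : r * S < d by nra.
have r2 : r + r < d by nra.
pose c s (u : 'rV[R]_k) := z + (s *: w + \sum_i u 0 i *: b i).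
have cz s u : `|s| <= r -> `|u| <= r -> `|c s u - z| < d.
  move=> sr ur; rewrite /c [z + _]addrC addrK (le_lt_trans _ rS)//.
  rewrite /S mulrDr (le_trans (ler_normD _ _))// lerD//.
    by rewrite normrZ ler_wpM2r.
  rewrite mulr_sumr (le_trans (ler_norm_sum _ _ _))// ler_sum// => i _.
  by rewrite normrZ ler_wpM2r// (le_trans _ ur)//; exact: coord_le_norm.
have cB s u : `|s| <= r -> `|u| <= r -> ball z rho (c s u).
  move=> sr ur; rewrite -ball_normE/= distrC.
  exact: lt_le_trans (cz _ _ sr ur) d_rho.
have cD s s' u u' : c s u = c s' u' +
    ((s - s') *: w + \sum_i (u - u') 0 i *: b i).
  rewrite /c -addrA; congr (z + _).
  rewrite addrACA -scalerDl [s' + _]addrC subrK; congr (_ + _).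
  rewrite -big_split/=; apply: eq_bigr => i _.
  by rewrite -scalerDl !mxE [u' 0 i + _]addrC subrK.
(* Since ['D_w h z = 0] and [J z] is the identity, [h (c s u)] is [u] up to an error of Lipschitz
   constant 1/2. This single estimate gives the stable ball, the contraction, the Lipschitz bound on
   [u] and [u 0 = 0]. *)
have K s s' u u' : `|s| <= r -> `|s'| <= r -> `|u| <= r -> `|u'| <= r ->
    `|h (c s u) - h (c s' u') - (u - u')| <= 2^-1 * (`|s - s'| + `|u - u'|).
  move=> sr sr' ur ur'.
  have small (V : normedZmodType R) (v v' : V) : `|v| <= r -> `|v'| <= r -> `|v - v'| < del.
    move=> vr vr'; rewrite (le_lt_trans (ler_normB _ _))//.
    by rewrite (lt_le_trans _ d_del)// (le_lt_trans _ r2)// lerD.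
  have := Hst (c s' u') (s - s') (u - u')
    (lt_le_trans (cz _ _ sr' ur') d_del) (small _ _ _ sr sr') (small _ _ _ ur ur').
  rewrite -cD -dhE// wz scaler0 add0r J_z mulmx1 => /le_trans; apply.
  rewrite invfM -mulrA ler_wpM2l// mulrDr lerD//.
    by rewrite ler_piMl// invf_le1// lerDl.
  by rewrite mulrA ler_piMl// mulrC ler_pdivrMr// mul1r lerDr.
have hc0 : h (c 0 0) = 0.
  by rewrite /c scale0r add0r big1 ?addr0// => i _; rewrite mxE scale0r.
have /choice[u uP] : forall s, exists u, `|s| <= r -> `|u| <= r /\ h (c s u) = 0.
  move=> s; have [sr|] := pselect (`|s| <= r); last by exists 0.
  have [||v vr vE] := @half_contraction_fixpoint R k r (fun v => v - h (c s v)) (ltW r0).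
  - move=> v vr.
    have := K s 0 v 0 sr; rewrite !normr0 hc0 !subr0 => /(_ (ltW r0) vr (ltW r0)).
    by rewrite distrC; lra.
  - move=> v v' vr vr'; have := K s s v v' sr sr vr vr'.
    rewrite subrr normr0 add0r; apply: le_trans.
    have -> : v - h (c s v) - (v' - h (c s v')) =
        - (h (c s v) - h (c s v') - (v - v')).
      by rewrite [RHS]opprB !opprD !opprK addrACA.
    by rewrite normrN.
  exists v => _; split=> //; move: vE => /eqP.
  by rewrite subr_eq -subr_eq0 opprD addNKr oppr_eq0 => /eqP.
have ur s : `|s| <= r -> `|u s| <= r by move=> /uP[].
have hu s : `|s| <= r -> h (c s (u s)) = 0 by move=> /uP[].
have uL s s' : `|s| <= r -> `|s'| <= r -> `|u s - u s'| <= `|s - s'|.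
  move=> sr sr'; have := K s s' _ _ sr sr' (ur s sr) (ur s' sr').
  by rewrite !hu// subrr sub0r normrN; lra.
have u0 : u 0 = 0.
  have r0' : `|0 : R| <= r by rewrite normr0 ltW.
  have z0 : `|0 : 'rV[R]_k| <= r by rewrite normr0 ltW.
  have := K 0 0 (u 0) 0 r0' r0' (ur _ r0') z0.
  rewrite hu// hc0 !subrr normr0 sub0r normrN subr0 add0r => h0.
  by apply/eqP; rewrite -normr_eq0; apply/eqP; have := normr_ge0 (u 0); lra.
exists r, u, rho; split => // s sr cc; rewrite -/(c s (u s)) in cc *.
have Bs : ball z rho (c s (u s)) by apply: cB; [exact: ltW|apply/ur/ltW].
have Us := rhoU _ Bs.
split=> //; first exact/hu/ltW.
pose q t : 'rV[R]_k := t^-1 *: (u (t + s) - u s).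
(* [h] vanishes at both ends of the chord, so the strict estimate at [c s (u s)] says that
   [dh w + q t *m J] is small; the Lipschitz bound on [u] makes the error proportional to [|t|]. *)
have qJ : q t *m J (c s (u s)) @[t --> 0^'] --> - dh w (c s (u s)).
  apply/cvgrPdist_le => eps epsp.
  have epsk : 0 < eps / (1 + k%:R) by rewrite divr_gt0.
  have [dl dl0 Hs] := strict_chart w Us epsk.
  near=> t.
  have t0 : t != 0 by near: t; exact: nbhs_dnbhs_neq.
  have tsr : `|t + s| <= r.
    rewrite (le_trans (ler_normD _ _))// -lerBrDr; apply: ltW.
    by near: t; apply: dnbhs0_lt; rewrite subr_gt0.
  have td : `|t| < dl by near: t; exact: dnbhs0_lt.
  have ut : `|u (t + s) - u s| <= `|t| by have := uL _ _ tsr (ltW sr); rewrite addrK.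
  have := Hs (c s (u s)) t (u (t + s) - u s).
  rewrite subrr normr0 => /(_ dl0 td (le_lt_trans ut td)).
  have := cD (t + s) s (u (t + s)) (u s); rewrite addrK => <-.
  rewrite !hu ?(ltW sr)// subrr sub0r normrN => Hle.
  rewrite -normrN opprB opprK -(ler_pM2l (x := `|t|)) ?normr_gt0// -normrZ.
  rewrite scalerDr /q -scalemxAl scalerA divff// scale1r addrC.
  rewrite (le_trans Hle)// mulrAC ler_pdivrMr//.
  rewrite [leRHS](_ : _ = eps * (`|t| + k%:R * `|t|)); last by ring.
  by rewrite ler_wpM2l ?(ltW epsp)// lerD2l ler_wpM2l.
have qk i : q t 0 i @[t --> 0^'] --> - kap w (c s (u s)) 0 i.
  have -> : - kap w (c s (u s)) 0 i =
     \sum_j (- dh w (c s (u s))) 0 j * invmx (J (c s (u s))) j i.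
    by rewrite /kap mxE -sumrN; apply: eq_bigr => j _; rewrite -mulNr [X in _ = X * _]mxE.
  have -> : (fun t => q t 0 i) = (fun t =>
     \sum_j (q t *m J (c s (u s))) 0 j * invmx (J (c s (u s))) j i).
    by apply/funext => t; rewrite -[in LHS](mulmxK (uJ _ Bs) (q t)) mxE.
  apply: cvg_sumr => j; apply: cvgM; last exact: cvg_cst.
  by move/cvg_mxP: qJ; exact.
move=> i.
have H : h^-1 *: (((fun s => u s 0 i) \o shift s) (h *: 1) - u s 0 i) @[h --> 0^']
    --> - kap w (c s (u s)) 0 i.
  apply: cvg_trans (qk i); apply: near_eq_cvg; near=> t.
  by rewrite /q /= [t%:A]mulr1 !mxE.
by apply: DeriveDef; [apply/cvg_ex; exists (- kap w (c s (u s)) 0 i)|exact: cvg_lim H].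
Unshelve. all: by end_near. Qed.

(** The implicit curve has velocity [w] at 0 because [kap w z = 0]. It is smooth by [Cn_curve]: its
    coefficients have derivatives 1 and [- kap w], evaluated at the curve point. *)
Lemma tangent_of_kernel (M : set E) w :
  (forall y, U y -> (M y <-> h y = 0)) -> M z -> 'D_w h z = 0 -> tangent M z w.
Proof.
move=> Mh Mz wz.
have [r [u [rho [r0 [rho0 rhoU] uJ u0 Hs]]]] := implicit_curve ((Mh z Uz).1 Mz) wz.
pose c s := z + (s *: w + \sum_i u s 0 i *: b i).
pose e (o : 'I_k.+1) := oapp b w (unlift ord0 o).
pose a (o : 'I_k.+1) s := oapp (u s 0) s (unlift ord0 o).
pose d (o : 'I_k.+1) y := oapp (fun i => - kap w y 0 i) 1 (unlift ord0 o).
pose I := [set s : R | `|s| < r].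
have oI : open I.
  have -> : I = ball (0 : R) r.
    by rewrite -ball_normE; apply/funext => s /=; rewrite /I/= sub0r normrN.
  exact: ball_open.
have ob : open (ball z rho) by exact: ball_open.
have cE s : c s = z + \sum_o a o s *: e o.
  rewrite big_ord_recl /a /e unlift_none /=.
  by under [in RHS]eq_bigr do rewrite liftK.
have ad o s : I s -> is_derive s (1 : R) (a o) (d o (c s)).
  move=> Is; have [_ _ ud] := Hs s Is; rewrite /a /d.
  case: (unlift ord0 o) => [i|]; [exact: ud|exact: is_derive_id].
have cB s : I s -> ball z rho (c s) by move=> Is; have [] := Hs s Is.
have Cd o q : Cn (ball z rho) q (d o).
  rewrite /d; case: (unlift ord0 o) => [i|] /=; last exact: Cn_cst.
  apply: Cn_ext (CnM ob (Cn_cst ob q (-1)) (Ckap w i q rhoU uJ)) => // y _ /=.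
  by rewrite mulN1r.
have cc s : I s -> {for s, continuous c}.
  move=> Is; rewrite (_ : c = fun s => z + \sum_o a o s *: e o); last exact/funext/cE.
  apply: cvgD; first exact: cvg_cst.
  apply: cvg_sumr => o; apply: cvgZ; last exact: cvg_cst.
  apply: differentiable_continuous; apply/derivable1_diffP.
  by have [] := ad o s Is.
have Cc i j q : Cn I q (fun s => c s i j).
  exact: (Cn_curve ob oI cB cc (fun s _ => cE s) ad Cd (Cn_coord i j q ob)).
have sc : smooth_on I c by exact: coord_smooth_on.
have I0 : I 0 by rewrite /I/= normr0.
have c0 : c 0 = z.
  by rewrite /c u0 scale0r add0r big1 ?addr0// => i _; rewrite mxE scale0r.
exists c, r; split=> //.
  by move=> s Is; have [Bs hs _] := Hs s Is; apply/Mh => //; exact: rhoU.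
have cd : derivable c 0 1 by have [_ + _] := (smooth_onP I c).1 sc; exact.
rewrite derive_mx//; apply/matrixP => i j; rewrite mxE.
have := @is_derive_comp_sum _ _ _ (fun x : E => x i j) e z c a (fun o => d o (c 0)) 0.
have fd o : \forall y \near c 0, derivable (fun x : E => x i j) y (e o).
  by near=> y; have [] := is_derive_coord y (e o) i j.
have dE v y : 'D_v (fun x : E => x i j) y = v i j.
  by have [_ ->] := is_derive_coord y v i j.
have fc o : {for c 0, continuous (fun y => 'D_(e o) (fun x : E => x i j) y)}.
  have -> : (fun y => 'D_(e o) (fun x : E => x i j) y) = cst (e o i j).
    by apply/funext => y; exact: dE.
  exact: cst_continuous.
have cEn : \forall s \near (0 : R), c s = z + \sum_o a o s *: e o.
  by near=> s; exact: cE.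
move=> /(_ fd fc cEn (fun o => ad o 0 I0))[_ ->].
under eq_bigr do rewrite dE.
rewrite big_ord_recl /d /e unlift_none /= mul1r big1 ?addr0// => o _.
by rewrite liftK /= c0 /kap -dhE// wz mul0mx mxE oppr0 mul0r.
Unshelve. all: by end_near. Qed.

End LocalChart.

Section Submanifold.
Variables (R : realType) (n p : nat).
Local Notation E := 'M[R]_(n, p).

Lemma matrix_sum_pair (v : E) :
  v = \sum_(o : 'I_n * 'I_p) v o.1 o.2 *: delta_mx o.1 o.2.
Proof. by rewrite [LHS]matrix_sum_delta pair_bigA. Qed.

(** [h] is constantly 0 along the curve; the curve is expanded in the canonical basis so that the
    chain rule applies. *)
Lemma kernel_of_tangent k (M U : set E) (h : E -> 'rV[R]_k) z v :
  open U -> smooth_on U h -> U z -> (forall y, U y -> (M y <-> h y = 0)) ->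
  tangent M z v -> 'D_v h z = 0.
Proof.
move=> oU sh Uz Mh [c [eps [eps0 sc cM c0 <-]]].
have I0 : `|0 : R| < eps by rewrite normr0.
have cd : derivable c 0 1 by exact: (sc [::] 0 I0).2.
have cc : {for 0, continuous c} by exact: (sc [::] 0 I0).1.
have hd : derivable h z ('D_1 c 0) by exact: (sh [::] z Uz).2.
rewrite derive_mx//; apply/matrixP => i l; rewrite ord1 !mxE.
pose hl y := h y 0 l.
have Ch m : Cn U m hl by exact: smooth_on_coord.
pose e (o : 'I_n * 'I_p) : E := delta_mx o.1 o.2.
have Uc : nbhs (c 0) U by rewrite c0; exact: open_nbhs_nbhs (conj oU Uz).
have fd o : \forall y \near c 0, derivable hl y (e o).
  by apply: filterS Uc => y Uy; exact: Cn_derivable Uy (Ch 1%N).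
have fc o : {for c 0, continuous (fun y => 'D_(e o) hl y)}.
  apply: (Cn_continuous (m := 0%N) _ (Cn_derive (e o) (Ch 1%N))).
  exact: nbhs_singleton Uc.
have cE : \forall s \near (0 : R), c s = 0 + \sum_o c s o.1 o.2 *: e o.
  by near=> s; rewrite add0r -matrix_sum_pair.
have ad (o : 'I_n * 'I_p) : is_derive (0 : R) (1 : R) (fun s => c s o.1 o.2) ('D_1 c 0 o.1 o.2).
  by apply: DeriveDef; [have /derivable_mxP := cd; exact|rewrite derive_mx// mxE].
have [_ d1] := is_derive_comp_sum fd fc cE ad.
have [_ d2] := derive_sum_dir (fun o : 'I_n * 'I_p => 'D_1 c 0 o.1 o.2) fd fc.
rewrite -matrix_sum_pair c0 in d2; rewrite [LHS]d2 -[in LHS]c0 -d1.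
rewrite (@near_eq_derive _ _ _ _ (cst 0)) ?derive_cst//.
have nU : \forall s \near (0 : R), U (c s) by exact: cc Uc.
have ne : \forall s \near (0 : R), `|s| < eps.
  apply/nbhs_ballP; exists eps => // s.
  by rewrite -ball_normE/= sub0r normrN.
near=> s; rewrite /= /hl.
have -> : h (c s) = 0; last by rewrite mxE.
apply/Mh; last apply: cM.
  by near: s.
by near: s.
Unshelve. all: by end_near. Qed.

Lemma tangent_lower_semicontinuous (M : set E) z v : embedded_submanifold M ->
  M z -> tangent M z v -> forall eps, 0 < eps ->
  \forall y \near z, M y -> exists2 v', `|v - v'| < eps & tangent M y v'.
Proof.
move=> Memb Mz vz eps eps0.
have [k Mk] := Memb; have [U [h [oU Uz sh Mh hs]]] := Mk z Mz.
have /choice[b hb] := fun i => hs z Uz Mz (delta_mx 0 i).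
have v0 : 'D_v h z = 0 by exact: (kernel_of_tangent oU sh Uz Mh vz).
have := kernel_lower_semicontinuous oU sh Uz hb v0 eps0.
have nU := open_nbhs_nbhs (conj oU Uz).
apply: filterS2 nU => y Uy [v' v'v hv'] My; exists v' => //.
(* The normalization of a chart concerns its base point only, so a new family is chosen at [y], with
   the same [U] and [h]. *)
have /choice[b' hb'] := fun i => hs y Uy My (delta_mx 0 i).
exact: (tangent_of_kernel oU sh Uy hb').
Qed.

End Submanifold.

(** * Projections, weights and retractions *)

Section OrthogonalProjection.
Variables (R : realType) (n p : nat).
Local Notation E := 'M[R]_(n, p).
Variables (T : E -> Prop) (P : E -> E).
Hypothesis PT : forall v, is_orth_proj T v (P v).

(* T is a mere set of vectors: the existence of orthogonal projections onto T
   forces it to be a linear subspace. *)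
Lemma frob_proj v e : T e -> frob (P v) e = frob v e.
Proof.
by move=> Te; have /eqP := (PT v).2 e Te; rewrite frobBl subr_eq0 => /eqP.
Qed.

(** The difference of the two sides is orthogonal to [T]. As [T] is not yet known to be linear, that
    difference is paired with each of its terms separately. *)
Lemma proj_linear a v w : P (a *: v + w) = a *: P v + P w.
Proof.
apply/eqP; rewrite -subr_eq0; apply/eqP/frob_eq0.
have H e : T e -> frob (P (a *: v + w) - (a *: P v + P w)) e = 0.
  by move=> Te; rewrite frobBl !frobDl !frobZl !frob_proj// frobDl frobZl subrr.
have Tp u : T (P u) by exact: (PT u).1.
by rewrite frobBr frobDr frobZr !H// mulr0 addr0 subrr.
Qed.

Lemma proj_id v : T v -> P v = v.
Proof.
move=> Tv; apply/eqP; rewrite -subr_eq0; apply/eqP/frob_eq0.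
by rewrite frobBr !frobBl !frob_proj ?subrr//; exact: (PT v).1.
Qed.

Lemma subspace_linear a v w : T v -> T w -> T (a *: v + w).
Proof. by move=> Tv Tw; rewrite -(proj_id Tv) -(proj_id Tw) -proj_linear; exact: (PT _).1. Qed.

Lemma subspace0 : T 0.
Proof.
have T0 := (PT 0).1.
by have := subspace_linear (-1) T0 T0; rewrite scaleN1r addNr.
Qed.

Lemma subspaceZ a v : T v -> T (a *: v).
Proof. by move=> Tv; rewrite -[a *: v]addr0; apply: subspace_linear => //; exact: subspace0. Qed.

Lemma linear_fun_continuous (A : E -> E) :
  (forall a u v, A (a *: u + v) = a *: A u + A v) -> continuous A.
Proof.
move=> Alin.
have A0 : A 0 = 0.
  have := Alin 1 0 0; rewrite !scale1r addr0 => /eqP.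
  by rewrite eq_sym -subr_eq0 addrK => /eqP.
have Asum (I : Type) (r : seq I) (a : I -> R) (e : I -> E) :
    A (\sum_(i <- r) a i *: e i) = \sum_(i <- r) a i *: A (e i).
  by elim: r => [|i r IH]; rewrite ?big_nil// !big_cons Alin IH.
have AE v : A v = \sum_(o : 'I_n * 'I_p) v o.1 o.2 *: A (delta_mx o.1 o.2).
  by rewrite {1}(matrix_sum_pair v) Asum.
rewrite (funext AE).
move=> v; apply: (@cvg_sumr _ _ _ _ (nbhs v) (nbhs_filter v)) => o.
by apply: cvgZ; [exact: coord_continuous|exact: cvg_cst].
Qed.

(** Heine-Borel, transported from row vectors through [vec_mx]. *)
Lemma mx_bounded_closed_compact (A : set E) (r : R) :
  (forall v, A v -> `|v| <= r) -> closed A -> compact A.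
Proof.
move=> Ar Acl; pose B := (@vec_mx R n p) @^-1` A.
have vc : continuous (@vec_mx R n p).
  move=> w; apply/(cvg_mxP (F := nbhs w)) => i j.
  under eq_cvg do rewrite mxE.
  by rewrite mxE; exact: coord_continuous.
have -> : A = (@vec_mx R n p) @` B.
  apply/seteqP; split=> [v Av|_ [w Bw <-]//].
  by exists (mxvec v); rewrite /B/= mxvecK.
apply: (continuous_compact (continuous_subspaceT vc)).
apply: bounded_closed_compact; last by apply: closed_comp => // w _; exact: vc.
exists r; split; first exact: num_real.
move=> r' rr' w /Ar vr; apply: (le_trans _ (ltW rr')).
have r0 : 0 <= r by exact: le_trans vr.
apply: norm_le_coord => // i l; rewrite ord1.
have [[a b] ->] : exists ab, l = mxvec_index ab.1 ab.2.
  by case/mxvec_indexP: l => a b; exists (a, b).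
by apply: le_trans vr; have := coord_le_norm (vec_mx w) a b; rewrite mxE.
Qed.

Variable W : E -> E.
Hypotheses (WT : forall e, T e -> T (W e))
  (Wlin : forall (a : R) e1 e2, T e1 -> T e2 -> W (a *: e1 + e2) = a *: W e1 + W e2)
  (Wsym : forall e1 e2, T e1 -> T e2 -> frob e1 (W e2) = frob (W e1) e2).

(* W is only linear on T. A minimizer of the Rayleigh quotient is an eigenvector:
   the form <e, W e> - lam <e, e> is nonnegative on T and vanishes there. *)
Lemma rayleigh_min e1 : T e1 -> e1 != 0 -> exists lam e0,
  [/\ T e0, e0 != 0, W e0 = lam *: e0 &
      forall e, T e -> lam * frob e e <= frob e (W e)].
Proof.
move=> Te1 e10; pose K := [set v : E | T v /\ frob v v = 1].
have Tn : exists2 v, T v & frob v v = 1.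
  exists ((frobn e1)^-1 *: e1); first exact: subspaceZ.
  rewrite frobZl frobZr -sqr_frobn expr2 !mulKf ?mulVf// gt_eqF//; exact: frobn_gt0.
(* [W] is linear on [T] alone; [W \o P] is linear everywhere. Likewise [T] is closed as the set of
   fixed points of [P]. *)
have Wc : continuous (W \o P).
  apply: linear_fun_continuous => a u v /=.
  by rewrite proj_linear Wlin//; exact: (PT _).1.
have Pc : continuous P by apply: linear_fun_continuous; exact: proj_linear.
have Kc : compact K.
  apply: (@mx_bounded_closed_compact _ 1).
    move=> v [_ v1]; apply: le_trans (norm_le_frobn _) _.
    by rewrite /frobn v1 sqrtr1.
  have -> : K = [set v | `|P v - v| = 0] `&` [set v | frob v v = 1].
    apply/seteqP; split=> v /= -[Tv v1]; split=> //; first by rewrite proj_id// subrr normr0.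
    by move/normr0_eq0/subr0_eq: Tv => <-; exact: (PT v).1.
  apply: closedI.
    apply: (@closed_comp _ _ (fun v => `|P v - v|) [set x | x = 0]); last exact: closed_eq.
    by move=> v _; exact: (cvg_norm (cvgB (Pc v) cvg_id)).
  apply: (@closed_comp _ _ (fun v : E => frob v v) [set x | x = 1]); last exact: closed_eq.
  by move=> v _; apply: (cvg_frob (F := nbhs v)); exact: cvg_id.
have [] := @compact_EVT_min _ R (fun v => frob v (W (P v))) K.
- by have [v Tv v1] := Tn; exists v.
- exact: Kc.
- apply: continuous_subspaceT => v; apply: (cvg_frob (F := nbhs v)); first exact: cvg_id.
  exact: Wc.
move=> e0 /set_mem[Te0 e01] e0min.
pose lam := frob e0 (W e0).
have min e : T e -> lam * frob e e <= frob e (W e).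
  move=> Te; have [->|en0] := eqVneq e 0; first by rewrite !frob0l mulr0.
  have fe := frobn_gt0 en0; have fe0 : frobn e != 0 by rewrite gt_eqF.
  have Ke : K ((frobn e)^-1 *: e).
    split; first exact: subspaceZ.
    by rewrite frobZl frobZr -sqr_frobn expr2 !mulKf ?mulVf.
  have := e0min _ (mem_set Ke); rewrite proj_id// (proj_id Ke.1).
  have -> : W ((frobn e)^-1 *: e) = (frobn e)^-1 *: W e.
    have W0 : W 0 = 0.
      have := Wlin 1 subspace0 subspace0; rewrite !scale1r addr0 => /eqP.
      by rewrite eq_sym -subr_eq0 addrK => /eqP.
    by have := Wlin (frobn e)^-1 Te subspace0; rewrite !addr0 W0 addr0.
  rewrite frobZl frobZr -/lam -sqr_frobn mulrA -invfM -expr2.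
  by rewrite -ler_pdivrMl ?invr_gt0 ?exprn_gt0// invrK mulrC.
have Tu : T (W e0 - lam *: e0).
  by rewrite addrC -scaleNr; apply: subspace_linear => //; exact: WT.
set u := W e0 - lam *: e0 in Tu.
have uE : frob u (W e0) - lam * frob u e0 = frob u u by rewrite /u [RHS]frobBr frobZr.
have e0n : e0 != 0.
  by apply/eqP => e00; move: e01; rewrite e00 frob0l => /esym/eqP; rewrite oner_eq0.
exists lam, e0; split=> //.
suff u0 : frob u u = 0 by apply/eqP; rewrite -subr_eq0; apply/eqP/frob_eq0.
clearbody u; set B := frob u u in uE *; pose C := frob u (W u) - lam * B.
(* Minimality at [t *: u + e0]. A nonnegative quadratic without constant term has no linear term; t
   = - B / (|C| + 1) makes this explicit and yields B = 0. *)
have quad t : 0 <= 2 * t * B + t ^+ 2 * C.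
  have := min _ (subspace_linear t Tu Te0).
  rewrite Wlin// !(frobDl, frobDr, frobZl, frobZr) (frobC e0 u) (Wsym Te0 Tu) (frobC _ u).
  rewrite -/lam e01 -/B -subr_ge0 => /le_trans; apply.
  rewrite le_eqVlt; apply/orP; left; apply/eqP.
  by rewrite /C -uE; ring.
have B0 : 0 <= B by exact: frob_ge0.
have C0 : 0 < `|C| + 1 by rewrite ltr_wpDl.
have := quad (- B / (`|C| + 1)) => q.
have {}q : 0 <= (- 2 * B ^+ 2 * (`|C| + 1) + B ^+ 2 * C) / (`|C| + 1) ^+ 2.
  by rewrite (le_trans q)// le_eqVlt; apply/orP; left; apply/eqP; field; rewrite gt_eqF.
rewrite pmulr_lge0 ?invr_gt0 ?exprn_gt0// in q.
have := ler_norm C => hC; have B2 : B ^+ 2 = 0 by nra.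
by apply/eqP; rewrite -sqrf_eq0 B2.
Qed.

End OrthogonalProjection.

Lemma rayleigh_bounds (R : realType) n p (T : 'M[R]_(n, p) -> Prop) P W (k1 k2 : R) :
  (forall v, is_orth_proj T v (P v)) ->
  (forall e, T e -> T (W e)) ->
  (forall (a : R) e1 e2, T e1 -> T e2 -> W (a *: e1 + e2) = a *: W e1 + W e2) ->
  (forall e1 e2, T e1 -> T e2 -> frob e1 (W e2) = frob (W e1) e2) ->
  (forall (lam : R) e, T e -> e != 0 -> W e = lam *: e -> k1 <= lam <= k2) ->
  forall e, T e -> k1 * frob e e <= frob e (W e) <= k2 * frob e e.
Proof.
move=> PT WT Wlin Wsym Wk e Te.
have [->|e0] := eqVneq e 0; first by rewrite !frob0l !mulr0 lexx.
have [lam [v [Tv v0 Wv vmin]]] := rayleigh_min PT WT Wlin Wsym Te e0.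
have /andP[k1lam _] := Wk _ _ Tv v0 Wv.
(* The largest eigenvalue of [W] is minus the smallest eigenvalue of [- W]. *)
have [|||lam' [v' [Tv' v0' Wv' vmin']]] := @rayleigh_min _ _ _ T P PT (fun e => - W e) _ _ _ _ Te e0.
- by move=> w Tw; rewrite -scaleN1r; apply: (subspaceZ PT); exact: WT.
- by move=> a w1 w2 T1 T2; rewrite Wlin// opprD scalerN.
- by move=> w1 w2 T1 T2; rewrite frobNr frobNl Wsym.
have /andP[_ lamk2] : k1 <= - lam' <= k2.
  by apply: (Wk _ _ Tv' v0'); rewrite scaleNr -Wv' opprK.
have := vmin _ Te; have := vmin' _ Te; rewrite frobNr.
by have := frob_ge0 e => *; apply/andP; split; nra.
Qed.

Section Retraction.
Variables (R : realType) (n p : nat).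
Local Notation E := 'M[R]_(n, p).

(** Let [Lam] be the derivative at [(zs, 0)], along the fibre, of a smooth extension of [Rt]. The
    strict estimate compares [Rt z xi - z] with [Lam xi] uniformly in [z], although [Lam] belongs to
    [zs]. The first-order condition on the retraction at [z] then shows that [Lam] nearly fixes
    tangent vectors at [z]. *)
Lemma retraction_first_order (M : set E) (Rt : E -> E -> E) (zs : E) :
  smooth_retraction M Rt -> M zs ->
  (forall z a v, M z -> tangent M z v -> tangent M z (a *: v)) ->
  tangent M zs 0 ->
  forall eps, 0 < eps -> exists2 del, 0 < del & forall z xi, M z ->
    `|z - zs| < del -> tangent M z xi -> `|xi| < del ->
    `|Rt z xi - z - xi| <= eps * `|xi|.
Proof.
move=> [_ R0 Rd Rs] Mzs TZ T0 eps eps0.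
have [U [G [oU Uz sG GE]]] := Rs (zs, 0) (conj Mzs T0).
have CG i j m : Cn U m (fun u => G u i j) by exact: smooth_on_coord.
pose e (o : 'I_n * 'I_p) : E * E := (0, delta_mx o.1 o.2).
pose N : R := 1 + (#|{: 'I_n * 'I_p}|)%:R.
have N0 : 0 < N by rewrite ltr_pwDl.
have eps1 : 0 < eps / 2 / N by rewrite !divr_gt0.
pose Pst (ij : 'I_n * 'I_p) (del : R) := forall x (a : 'I_n * 'I_p -> R),
  `|x - (zs, 0)| < del -> (forall o, `|a o| < del) ->
  `|G (x + \sum_o a o *: e o) ij.1 ij.2 - G x ij.1 ij.2 -
     \sum_o a o * 'D_(e o) (fun u => G u ij.1 ij.2) (zs, 0)|
   <= eps / 2 / N * \sum_o `|a o|.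
have nU := open_nbhs_nbhs (conj oU Uz).
have [||d1 d10 Hst] := @common_radius R _ Pst.
- move=> ij d d' d'd H x a xd ad; apply: H; first exact: lt_le_trans d'd.
  by move=> i; apply: lt_le_trans d'd.
- move=> ij; apply: strict_derive_fin => // o.
    by apply: filterS nU => y Uy; exact: Cn_derivable Uy (CG _ _ 1%N).
  exact: Cn_continuous Uz (Cn_derive (e o) (CG ij.1 ij.2 1%N)).
have /nbhs_normP[d2 /= d20 HU] := nU.
pose Lam (xi : E) : E := \matrix_(i, j) \sum_o xi o.1 o.2 *
  'D_(e o) (fun u => G u i j) (zs, 0).
have LamZ s xi : Lam (s *: xi) = s *: Lam xi.
  apply/matrixP => i j; rewrite !mxE mulr_sumr; apply: eq_bigr => o _.
  by rewrite mxE mulrA.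
have pairnorm (v w : E) (d : R) : `|v| < d -> `|w| < d -> `|(v, w) : E * E| < d.
  by move=> vd wd; rewrite prod_normE gt_max vd.
pose d := Num.min d1 d2.
have dd1 : d <= d1 by rewrite ge_min lexx.
have dd2 : d <= d2 by rewrite ge_min lexx orbT.
have key z xi : M z -> `|z - zs| < d -> tangent M z xi -> `|xi| < d ->
    `|Rt z xi - z - Lam xi| <= eps / 2 * `|xi|.
  move=> Mz zd Tx xd.
  have UG w : tangent M z w -> `|w| < d -> G (z, w) = Rt z w.
    move=> Tw wd; apply: GE; last by [].
    apply: HU => /=; rewrite distrC.
    have -> : (z, w) - (zs, 0) = (z - zs, w - 0) by [].
    rewrite subr0.
    by apply: lt_le_trans dd2; exact: pairnorm.
  have T00 : tangent M z 0 by rewrite -(scale0r xi); exact: TZ.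
  have n00 : `|0 : E| < d by rewrite normr0 (le_lt_trans _ xd).
  rewrite -UG// -[X in _ - X - _](R0 z Mz) -UG//.
  apply: norm_le_coord => [|i j]; first by rewrite mulr_ge0// divr_ge0// ltW.
  have := Hst (i, j) (z, 0) (fun o => xi o.1 o.2).
  have -> : (z, 0) - (zs, 0) = (z - zs, 0 - 0) :> E * E by [].
  rewrite subr0.
  have -> : (z, 0) + \sum_o xi o.1 o.2 *: e o = (z, xi).
    have -> : \sum_o xi o.1 o.2 *: e o = (0, xi).
      rewrite [in RHS](matrix_sum_pair xi).
      elim/big_rec2: _ => // o w y _ ->.
      have -> : xi o.1 o.2 *: e o + (0, w) =
        (xi o.1 o.2 *: 0 + 0, xi o.1 o.2 *: delta_mx o.1 o.2 + w) by [].
      by rewrite scaler0 add0r.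
    have -> : (z, 0) + (0, xi) = (z + 0, 0 + xi) by [].
    by rewrite addr0 add0r.
  move=> /(_ (lt_le_trans (pairnorm _ _ _ zd n00) dd1)).
  have xod o : `|xi o.1 o.2| < d1.
    by rewrite (lt_le_trans _ dd1)// (le_lt_trans _ xd)//; exact: coord_le_norm.
  move=> /(_ xod) /= H; rewrite !mxE; apply: (le_trans H).
  rewrite -mulrA ler_wpM2l ?divr_ge0 ?(ltW eps0)// ler_pdivrMl//.
  apply: (@le_trans _ _ (\sum_(o : 'I_n * 'I_p) `|xi|)).
    by apply: ler_sum => o _; exact: coord_le_norm.
  by rewrite sumr_const -mulr_natl ler_wpM2r// lerDr.
exists d; first by rewrite lt_min d10.
move=> z xi Mz zd Tx xd.
(* The estimate [key] at [s *: xi], divided by [s], with [s] tending to 0. *)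
have xLam : `|xi - Lam xi| <= eps / 2 * `|xi|.
  apply/ler_addgt0Pr => eta eta0.
  have [/cvg_ex[l Hl] dv] := Rd z xi Mz Tx.
  have lxi : l = xi by rewrite -dv; apply/esym; exact: cvg_lim Hl.
  rewrite lxi in Hl; move/cvgrPdist_le/(_ _ eta0): Hl => Hl.
  near (0 : R)^' => s.
  have s0 : s != 0 by near: s; exact: nbhs_dnbhs_neq.
  have s1 : `|s| < 1 by near: s; exact: dnbhs0_lt.
  have sxd : `|s *: xi| < d.
    by rewrite normrZ (le_lt_trans _ xd)// ler_piMl// ltW.
  have := key z (s *: xi) Mz zd (TZ _ _ _ Mz Tx) sxd.
  have : `|xi - s^-1 *: (Rt z (s *: xi) - z)| <= eta.
    have : `|xi - s^-1 *: (((fun s => Rt z (s *: xi)) \o shift 0) (s *: 1) -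
      Rt z (0 *: xi))| <= eta by near: s; exact: Hl.
    by rewrite /= [s%:A]mulr1 addr0 scale0r R0.
  rewrite LamZ normrZ => h1 h2.
  have h3 : `|s^-1 *: (Rt z (s *: xi) - z) - Lam xi| <= eps / 2 * `|xi|.
    rewrite -(ler_pM2l (x := `|s|)) ?normr_gt0// -normrZ scalerBr scalerA divff//.
    by rewrite scale1r mulrCA.
  rewrite -(subrKA (s^-1 *: (Rt z (s *: xi) - z))) (le_trans (ler_normD _ _))//.
  by rewrite addrC lerD.
have -> : Rt z xi - z - xi = (Rt z xi - z - Lam xi) - (xi - Lam xi).
  by rewrite opprB addrA subrK.
rewrite (le_trans (ler_normB _ _))// [eps]splitr mulrDl lerD//; exact: key.
Unshelve. all: by end_near. Qed.

End Retraction.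

(** * Convex functions and the Clarke subdifferential *)

Section ConvexFunctions.
Variables (R : realType) (n p : nat).
Local Notation E := 'M[R]_(n, p).

Lemma convex_locally_lipschitz (g : E -> R) zs : continuous g -> convex_fun g ->
  exists K del : R, [/\ 0 <= K, 0 < del & forall z z', `|z - zs| < del ->
    `|z' - zs| < del -> `|g z - g z'| <= K * `|z - z'|].
Proof.
move=> gc gconv.
have /nbhs_normP[rho /= rho0 Hg] : \forall y \near zs, `|g zs - g y| <= 1.
  by have /cvgrPdist_le/(_ 1 ltr01) := gc zs.
pose del := rho / 2; have del0 : 0 < del by rewrite divr_gt0.
have onesided z z' : `|z - zs| < del -> `|z' - zs| < del ->
    g z' - g z <= 2 / del * `|z' - z|.
  move=> zd zd'; have [->|zz'] := eqVneq z' z; first by rewrite !subrr normr0 mulr0.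
  set d := `|z' - z|; have d0 : 0 < d by rewrite normr_gt0 subr_eq0.
  (* Prolongs the segment from [z] to [z'] by the length [del]. As rho = 2 del, [g] is still within
     1 of [g zs] at [y], and convexity turns [g y - g z <= 2] into a slope bound. *)
  pose y := z' + (del / d) *: (z' - z).
  pose a := del / (del + d).
  have dd0 : 0 < del + d by rewrite addr_gt0.
  have a1 : 1 - a = d / (del + d) by rewrite /a; field; rewrite gt_eqF.
  have a01 : 0 <= a <= 1.
    by rewrite divr_ge0 ?(ltW del0) ?(ltW dd0)//= ler_pdivrMr// mul1r lerDl ltW.
  have yE : a *: z + (1 - a) *: y = z'.
    rewrite /y scalerDr scalerA a1 scalerBr.
    have -> : d / (del + d) * (del / d) = a by rewrite /a; field; rewrite !gt_eqF.
    rewrite addrCA [a *: z + _]addrC subrK -scalerDl -[RHS]scale1r; congr (_ *: _).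
    by rewrite /a; field; rewrite gt_eqF.
  have := gconv z y a a01; rewrite yE => gz'.
  have Hy : `|g zs - g y| <= 1.
    apply: Hg => /=; rewrite distrC [rho]splitr /y addrAC.
    rewrite (le_lt_trans (ler_normD _ _))// ltr_leD//.
    have dl0 : 0 <= del / d by rewrite ltW// divr_gt0.
    rewrite normrZ (ger0_norm dl0).
    have dN : d != 0 by rewrite gt_eqF.
    by rewrite [leLHS](divfK dN).
  have Hz : `|g zs - g z| <= 1.
    apply: Hg => /=; rewrite distrC (lt_trans zd)// /del.
    by rewrite ltr_pdivrMr// mulr_natr mulr2n ltrDl.
  have gyz : g y - g z <= 2 by move: Hy Hz; rewrite !ler_norml => /andP[? ?] /andP[? ?]; lra.
  have h1 : g z' - g z <= (1 - a) * (g y - g z) by lra.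
  apply: (le_trans h1); rewrite a1.
  apply: (@le_trans _ _ (d / (del + d) * 2)).
    by rewrite ler_wpM2l// divr_ge0 ?(ltW d0) ?(ltW dd0).
  have -> : 2 / del * d = d / del * 2 by field; rewrite gt_eqF.
  by rewrite ler_wpM2r// (ler_wpM2l (ltW d0))// lef_pV2// lerDl ltW.
exists (2 / del), del; split => //; first by rewrite divr_ge0// ltW.
move=> z z' zd zd'; rewrite ler_norml; apply/andP; split.
  by have := onesided z z' zd zd'; rewrite distrC; lra.
by have := onesided z' z zd' zd; lra.
Qed.

Lemma convex_segment (g : E -> R) z e s : convex_fun g -> 0 <= s <= 1 ->
  g (z + s *: e) - g z <= s * (g (z + e) - g z).
Proof.
move=> gconv s01; have := gconv (z + e) z s s01.
have -> : s *: (z + e) + (1 - s) *: z = z + s *: e.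
  rewrite scalerDr scalerBl scale1r [s *: z + _]addrC addrACA subrr addr0.
  exact: addrC.
by lra.
Qed.

(** Slopes of a convex function increase along a ray, so the Lipschitz bound on a short piece
    [s *: e] inside the ball bounds the slope from below for every [e], however long. *)
Lemma convex_lower_bound (g : E -> R) zs K del : convex_fun g -> 0 <= K ->
  (forall z z', `|z - zs| < del -> `|z' - zs| < del ->
     `|g z - g z'| <= K * `|z - z'|) ->
  forall z e, `|z - zs| < del -> - (K * `|e|) <= g (z + e) - g z.
Proof.
move=> gconv K0 gK z e zd.
have r0 : 0 < del - `|z - zs| by rewrite subr_gt0.
have e1 : 0 < 1 + `|e| by rewrite ltr_pwDl.
pose s := Num.min 1 ((del - `|z - zs|) / (1 + `|e|)).
have s0 : 0 < s by rewrite lt_min ltr01 divr_gt0.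
have s1 : s <= 1 by rewrite ge_min lexx.
have se : s * `|e| < del - `|z - zs|.
  apply: (@lt_le_trans _ _ (s * (1 + `|e|))); first by rewrite ltr_pM2l// ltrDr.
  by rewrite -ler_pdivlMr// ge_min lexx orbT.
have zed : `|z + s *: e - zs| < del.
  rewrite addrAC (le_lt_trans (ler_normD _ _))// normrZ (ger0_norm (ltW s0)).
  by rewrite -ltrBrDl.
have := gK _ _ zed zd; rewrite [z + _ - z]addrAC subrr add0r normrZ (ger0_norm (ltW s0)).
rewrite ler_norml => /andP[h _].
have := @convex_segment g z e s gconv; rewrite s1 (ltW s0) => /(_ isT).
move=> h2.
by rewrite -(ler_pM2l s0); lra.
Qed.

(* One step of Hahn-Banach, in the orthogonal form xi' = xi + a q with q the
   component of e orthogonal to T. *)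
Lemma convex_extension_step (T : E -> Prop) (P : E -> E) (xi : E) (phi : E -> R) e :
  (forall v, is_orth_proj T v (P v)) -> convex_fun phi ->
  (forall v, T v -> frob xi v <= phi v) ->
  exists (T' : E -> Prop) (P' : E -> E) (xi' : E),
  [/\ forall v, is_orth_proj T' v (P' v), forall v, T v -> T' v, T' e,
      forall v, T' v -> frob xi' v <= phi v &
      forall v, T v -> frob xi' v = frob xi v].
Proof.
move=> PT pconv xiT; have [Te|nTe] := pselect (T e); first by exists T, P, xi.
pose q := e - P e.
have q0 : q != 0.
  by rewrite subr_eq0; apply: contra_not_neq nTe => ->; exact: (PT e).1.
have qT v : T v -> frob q v = 0 by exact: (PT e).2.
have Teq : T (e - q) by rewrite /q opprB addrCA subrr addr0; exact: (PT e).1.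
clearbody q.
have qq : 0 < frob q q by rewrite -sqr_frobn exprn_gt0// frobn_gt0.
have qqN : frob q q != 0 by rewrite gt_eqF.
have TL := subspace_linear PT.
have T0 := subspace0 PT.
have TZ := subspaceZ PT.
(* Every lower slope is at most every upper slope: with weights t / (t + t') and t' / (t + t') the
   multiples of [q] cancel, leaving a point of [T]. *)
have cross s s' t t' : T s -> T s' -> 0 < t -> 0 < t' ->
    (frob xi s' - phi (s' - t' *: q)) / t' <= (phi (s + t *: q) - frob xi s) / t.
  move=> Ts Ts' t0 t'0; have tt : 0 < t + t' by rewrite addr_gt0.
  have ttN : t + t' != 0 by rewrite gt_eqF.
  pose a := t / (t + t').
  have a01 : 0 <= a <= 1.
    by rewrite divr_ge0 ?(ltW t0) ?(ltW tt)//= ler_pdivrMr// mul1r lerDl ltW.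
  have a1 : 1 - a = t' / (t + t') by rewrite /a; field.
  have := pconv (s' - t' *: q) (s + t *: q) a a01.
  have -> : a *: (s' - t' *: q) + (1 - a) *: (s + t *: q) = a *: s' + (1 - a) *: s.
    rewrite scalerBr scalerDr !scalerA a1.
    have -> : t' / (t + t') * t = a * t' by rewrite /a; field.
    by rewrite addrACA [- _ + _]addrC subrr addr0.
  have := xiT _ (TL a _ _ Ts' (TZ (1 - a) _ Ts)).
  rewrite frobDr !frobZr a1 /a => h1 h2.
  have := le_trans h1 h2.
  set x1 := frob xi s'; set x2 := frob xi s; set p1 := phi _; set p2 := phi _.
  rewrite -(ler_pM2l tt).
  have -> : (t + t') * (t / (t + t') * x1 + t' / (t + t') * x2) = t * x1 + t' * x2 by field.
  have -> : (t + t') * (t / (t + t') * p1 + t' / (t + t') * p2) = t * p1 + t' * p2 by field.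
  move=> h3; rewrite ler_pdivlMr// mulrAC ler_pdivrMr//; lra.
pose A := [set x : R | exists s t, [/\ T s, 0 < t & x = (frob xi s - phi (s - t *: q)) / t]].
have An : A !=set0 by exists ((frob xi 0 - phi (0 - 1 *: q)) / 1), 0, 1.
have Aub s t : T s -> 0 < t -> ubound A ((phi (s + t *: q) - frob xi s) / t).
  by move=> Ts t0 _ [s' [t' [Ts' t'0 ->]]]; exact: cross.
have supA : has_sup A by split=> //; exists ((phi (0 + 1 *: q) - frob xi 0) / 1); exact: Aub.
(* The value of [xi'] on [q], squeezed between the lower and the upper slopes. *)
pose c := sup A.
have c1 s t : T s -> 0 < t -> c <= (phi (s + t *: q) - frob xi s) / t.
  by move=> Ts t0; apply: ge_sup => //; exact: Aub.
have c2 s t : T s -> 0 < t -> (frob xi s - phi (s - t *: q)) / t <= c.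
  by move=> Ts t0; apply: sup_upper_bound => //; exists s, t.
pose xi' := xi + ((c - frob xi q) / frob q q) *: q.
have xi'T v : T v -> frob xi' v = frob xi v.
  by move=> Tv; rewrite /xi' frobDl frobZl (qT _ Tv) mulr0 addr0.
have xi'q : frob xi' q = c by rewrite /xi' frobDl frobZl divfK// addrC subrK.
exists (fun v => exists2 t, T (v - t *: q) & True), (fun v => P v + (frob q v / frob q q) *: q), xi'.
split.
- move=> v; split; first by exists (frob q v / frob q q) => //; rewrite addrK; exact: (PT v).1.
  move=> u [t Tu _]; rewrite -(subrK (t *: q) u) opprD addrA.
  rewrite frobDr frobZr !frobBl !frobZl (qT _ Tu) mulr0 subr0.
  rewrite (frob_proj PT)// subrr add0r divfK//.
  by rewrite (frobC (P v)) (qT _ (PT v).1) subr0 frobC subrr mulr0.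
- by move=> v Tv; exists 0 => //; rewrite scale0r subr0.
- by exists 1 => //; rewrite scale1r.
- move=> v [t Tv _]; rewrite -(subrK (t *: q) v); set s := v - t *: q in Tv *.
  rewrite frobDr frobZr xi'q xi'T//.
  have [t0|t0|->] := ltrgt0P t; last by rewrite mul0r scale0r !addr0; exact: xiT.
    by have := c1 s t Tv t0; rewrite ler_pdivlMr//; lra.
  have nt0 : 0 < - t by rewrite oppr_gt0.
  by have := c2 s (- t) Tv nt0; rewrite scaleNr opprK ler_pdivrMr//; lra.
- exact: xi'T.
Qed.

(** The zero functional is below [phi] on [T]; it is extended along the canonical basis matrices one
    by one until the subspace is the whole space. *)
Lemma convex_separation (T : E -> Prop) (P : E -> E) (phi : E -> R) :
  (forall v, is_orth_proj T v (P v)) -> convex_fun phi ->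
  (forall v, T v -> 0 <= phi v) ->
  exists xi, (forall v, frob xi v <= phi v) /\ (forall v, T v -> frob xi v = 0).
Proof.
move=> PT pconv phiT.
have [T' [P' [xi [PT' TT' rT' xiT' xi0]]]] : exists (T' : E -> Prop) (P' : E -> E) (xi : E),
    [/\ forall v, is_orth_proj T' v (P' v), forall v, T v -> T' v,
        forall o, o \in enum {: 'I_n * 'I_p} -> T' (delta_mx o.1 o.2),
        forall v, T' v -> frob xi v <= phi v & forall v, T v -> frob xi v = 0].
  elim: (enum _) => [|o r [T' [P' [xi [PT' TT' rT' xiT' xi0]]]]].
    exists T, P, 0; split=> // v Tv; last by rewrite frob0l.
    by rewrite frob0l phiT.
  have [T'' [P'' [xi' [PT'' TT'' eT xiT'' xi'E]]]] :=
    convex_extension_step (delta_mx o.1 o.2) PT' pconv xiT'.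
  exists T'', P'', xi'; split=> //; first by move=> v /TT' /TT''.
    by move=> o'; rewrite inE => /predU1P[->//|/rT' /TT''].
  by move=> v Tv; rewrite xi'E ?xi0//; exact: TT'.
exists xi; split=> // v; apply: xiT'; rewrite (matrix_sum_pair v).
elim/big_rec: _ => [|o w _ Tw]; first exact: (subspace0 PT').
by apply: (subspace_linear PT') => //; apply: rT'; rewrite mem_enum.
Qed.

End ConvexFunctions.

Section Smooth.
Variables (R : realType) (n p : nat).
Local Notation E := 'M[R]_(n, p).

Lemma quadratic_bound (f : E -> R) (gradf : E -> E) (L : R) :
  (forall z, differentiable f z) -> (forall z v, 'd f z v = frob (gradf z) v) ->
  0 < L -> (forall z1 z2, frobn (gradf z1 - gradf z2) <= L * frobn (z1 - z2)) ->
  forall z v, `|f (z + v) - f z - frob (gradf z) v| <= L * frobn v ^+ 2.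
Proof.
move=> fd fE L0 fL z v.
have [s|s /andP[s0 s1]] := @MVT_line R E f z v 1; first by move=> _; exact: diff_derivable.
rewrite scale1r mulr1 mul1r => ->; rewrite deriveE// fE -frobBl.
rewrite (le_trans (frob_le_frobn _ _))// expr2 mulrA ler_wpM2r ?frobn_ge0//.
rewrite (le_trans (fL _ _))// ler_wpM2l ?(ltW L0)// [z + _]addrC addrK frobnZ ger0_norm//.
by rewrite ler_piMl ?frobn_ge0.
Qed.

Lemma clarke_subdiff_sum (f g : E -> R) (G xi : E) (L : R) z :
  0 < L -> (forall v, `|f (z + v) - f z - frob G v| <= L * frobn v ^+ 2) ->
  (forall v, frob xi v <= frob G v + g (z + v) - g z) ->
  clarke_subdiff (fun y => f y + g y) z xi.
Proof.
move=> L0 fL gxi v; (* The base point z itself is admissible in the limsup. *)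
apply: le_ereal_inf_tmp => _ [d /= d0 <-].
apply/lee_addgt0Pr => eps eps0.
have c0 : 0 < 1 + L * frobn v ^+ 2 by rewrite ltr_pwDl// mulr_ge0 ?sqr_ge0// ltW.
(* Small enough to be admissible for [d] and to make the quadratic error of [f], once divided by
   [t], at most eps. *)
pose t := Num.min (d / 2) (eps / (1 + L * frobn v ^+ 2)).
have t0 : 0 < t by rewrite lt_min !divr_gt0.
have td : t < d by rewrite gt_min ltr_pdivrMr// mulr_natr mulr2n ltrDl d0.
have teps : t * (L * frobn v ^+ 2) <= eps.
  apply: (@le_trans _ _ (t * (1 + L * frobn v ^+ 2))).
    by rewrite ler_wpM2l ?(ltW t0)// lerDr.
  by rewrite -ler_pdivlMr// ge_min lexx orbT.
apply: (@le_trans _ _ ((((f (z + t *: v) + g (z + t *: v)) - (f z + g z)) / t)%:E + eps%:E)%E).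
  rewrite -EFinD lee_fin -lerBlDr ler_pdivlMr//.
  have := fL (t *: v); have := gxi (t *: v).
  rewrite ler_norml !frobZr frobnZ gtr0_norm// => h1 /andP[h2 _].
  have h3 : t * (t * (L * frobn v ^+ 2)) <= t * eps by rewrite ler_wpM2l// ltW.
  rewrite exprMn in h2; lra.
apply: leeD => //; apply: ereal_sup_ubound => /=.
exists (z, t) => //=; split; last by rewrite t0 td.
by rewrite subrr /frobn frob0l sqrtr0.
Qed.

End Smooth.

(** * Convergence of the safeguard iterates *)

Section ProximalStep.
Variables (R : realType) (n p : nat).
Local Notation E := 'M[R]_(n, p).

(** Comparing [eta] with 0 alone would give half of this decrease, which is too little for the whole
    range sigma < kappa / mu. *)
Lemma proximal_descent (T : E -> Prop) P (W : E -> E) (g : E -> R) (G z eta : E) (mu : R) :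
  (forall v, is_orth_proj T v (P v)) ->
  (forall (a : R) e1 e2, T e1 -> T e2 -> W (a *: e1 + e2) = a *: W e1 + W e2) ->
  convex_fun g -> T eta ->
  (forall e, T e ->
     frob G eta + 1 / (2 * mu) * frob eta (W eta) + g (z + eta)
       <= frob G e + 1 / (2 * mu) * frob e (W e) + g (z + e)) ->
  0 < mu -> 0 <= frob eta (W eta) ->
  frob G eta + g (z + eta) - g z <= - (frob eta (W eta) / mu).
Proof.
move=> PT Wlin gconv Teta opt mu0 q0.
set q := frob eta (W eta) in q0 opt *.
have W0 : W 0 = 0.
  have := Wlin 1 _ _ (subspace0 PT) (subspace0 PT); rewrite !scale1r addr0 => /eqP.
  by rewrite eq_sym -subr_eq0 addrK => /eqP.
pose Q := 1 / (2 * mu) * q.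
have QE : q / mu = 2 * Q by rewrite /Q; field; rewrite gt_eqF.
have Q0 : 0 <= Q by rewrite mulr_ge0// divr_ge0// mulr_ge0// ltW.
set D := frob G eta + g (z + eta) - g z.
(* Compare eta with (1 - a) eta and let a tend to 0. *)
have key a : 0 < a <= 1 -> D <= (a - 2) * Q.
  move=> /andP[a0 a1]; have b01 : 0 <= 1 - a <= 1 by lra.
  have := opt _ (subspaceZ PT (1 - a) Teta).
  have -> : W ((1 - a) *: eta) = (1 - a) *: W eta.
    by have := Wlin (1 - a) _ _ Teta (subspace0 PT); rewrite !addr0 W0 addr0.
  rewrite frobZr frobZl frobZr -/q.
  have := convex_segment z eta gconv b01.
  set g1 := g (z + eta); set g0 := g z; set ga := g _ => h1 h2.
  rewrite -(ler_pM2l a0) /D -/g1 -/g0 /Q.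
  set m := 1 / (2 * mu) in h2 *; lra.
rewrite QE -mulNr; apply/ler_addgt0Pr => eps eps0.
have Q1 : 0 < Q + 1 by rewrite ltr_wpDl.
pose a := Num.min 1 (eps / (Q + 1)).
have a0 : 0 < a by rewrite lt_min ltr01 divr_gt0.
have a1 : a <= 1 by rewrite ge_min lexx.
have ae : a * (Q + 1) <= eps by rewrite -ler_pdivlMr// ge_min lexx orbT.
have a01 : 0 < a <= 1 by rewrite a0.
by have := key a a01; nra.
Qed.

Lemma smooth_locally_lipschitz (f : E -> R) (gradf : E -> E) (L : R) (zs : E) :
  (forall z v, `|f (z + v) - f z - frob (gradf z) v| <= L * frobn v ^+ 2) ->
  continuous gradf -> 0 < L ->
  exists K del : R, [/\ 0 <= K, 0 < del & forall z z', `|z - zs| < del ->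
    `|z' - zs| < del -> `|f z - f z'| <= K * `|z - z'|].
Proof.
move=> fq gc L0.
pose B := frobn (gradf zs) + 1.
have /nbhs_normP[d /= d0 Hd] : \forall y \near zs, `|frobn (gradf zs) - frobn (gradf y)| <= 1.
  have := @cvg_frobn R n p _ (nbhs zs) (nbhs_filter zs) gradf (gradf zs) (gc zs).
  by move/cvgrPdist_le/(_ 1 ltr01).
pose c : R := frob_cst R n p; have c0 : 0 < c by exact: frob_cst_gt0.
exists (B * c + L * c ^+ 2 * (2 * d)), d; split=> //.
  rewrite addr_ge0// ?mulr_ge0 ?addr_ge0 ?frobn_ge0 ?sqr_ge0//; exact: ltW.
move=> z z' zd zd'; have := fq z' (z - z'); rewrite [z' + _]addrC subrK.
have := Hd z'; rewrite /= distrC => /(_ zd').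
rewrite ler_norml => /andP[h1 _].
have hB : frobn (gradf z') <= B by rewrite /B; lra.
have := frob_le_frobn (gradf z') (z - z').
have := frobn_le_norm (z - z'); rewrite -/c.
have : `|z - z'| <= 2 * d.
  have -> : z - z' = (z - zs) - (z' - zs) by rewrite opprB addrA subrK.
  by rewrite (le_trans (ler_normB _ _))//; lra.
have := frobn_ge0 (z - z'); have := frobn_ge0 (gradf z'); have := normr_ge0 (z - z').
set N := `|z - z'|; set r := frobn (z - z'); set G := frobn (gradf z').
set fr := frob _ _ => N0 G0 r0 N2 rN frG fq'.
have h2 : `|fr| <= B * c * N.
  apply: (le_trans frG); rewrite -mulrA; exact: ler_pM.
have h3 : L * r ^+ 2 <= L * c ^+ 2 * (2 * d) * N.
  have -> : L * c ^+ 2 * (2 * d) * N = L * (c ^+ 2 * (2 * d * N)) by ring.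
  rewrite ler_wpM2l ?(ltW L0)//; apply: (@le_trans _ _ ((c * N) ^+ 2)).
    by rewrite ler_pXn2r ?nnegrE// mulr_ge0// ltW.
  rewrite exprMn ler_wpM2l ?sqr_ge0// expr2.
  by rewrite ler_wpM2r.
rewrite -(subrK fr (f z - f z')) mulrDl addrC (le_trans (ler_normD _ _))// lerD//.
exact: le_trans h3.
Qed.

End ProximalStep.

Section Convergence.
Variables (R : realType) (n p : nat).
Local Notation E := 'M[R]_(n, p).
Variables (M : set E) (Rt : E -> E -> E) (f g : E -> R) (gradf : E -> E) (L : R).
Variables (P W : E -> E -> E) (kappa kappat : R) (eta : E -> E) (mu sigma nu : R).
Let F := fun z => f z + g z.
Hypotheses (Memb : embedded_submanifold M) (Rsm : smooth_retraction M Rt).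
Hypothesis fq : forall z v, `|f (z + v) - f z - frob (gradf z) v| <= L * frobn v ^+ 2.
Hypotheses (gradc : continuous gradf) (L0 : 0 < L).
Hypotheses (gc : continuous g) (gconv : convex_fun g).
Hypothesis PT : forall z, M z -> forall v, is_orth_proj (tangent M z) v (P z v).
Hypothesis kappa0 : 0 < kappa.
Hypothesis Wlin : forall z, M z -> forall (a : R) e1 e2, tangent M z e1 -> tangent M z e2 ->
  W z (a *: e1 + e2) = a *: W z e1 + W z e2.
Hypothesis Wk : forall z, M z -> forall e, tangent M z e ->
  kappa * frob e e <= frob e (W z e) <= kappat * frob e e.
Hypotheses (mu0 : 0 < mu) (sigma0 : 0 < sigma) (sigmak : sigma < kappa / mu).
Hypothesis nu0 : 0 < nu.
Hypothesis etaT : forall z, M z -> tangent M z (eta z).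
Hypothesis etamin : forall z, M z -> forall e, tangent M z e ->
  frob (gradf z) (eta z) + 1 / (2 * mu) * frob (eta z) (W z (eta z)) + g (z + eta z)
    <= frob (gradf z) e + 1 / (2 * mu) * frob e (W z e) + g (z + e).

Let eta_descent z : M z ->
  frob (gradf z) (eta z) + g (z + eta z) - g z <= - (kappa / mu * frobn (eta z) ^+ 2).
Proof.
move=> Mz; have /andP[k1 _] := Wk Mz (etaT Mz).
have q0 : 0 <= frob (eta z) (W z (eta z)).
  by rewrite (le_trans _ k1)// mulr_ge0 ?frob_ge0// ltW.
apply: (le_trans (proximal_descent (PT Mz) (Wlin Mz) gconv (etaT Mz) (etamin Mz) mu0 q0)).
by rewrite lerN2 mulrAC ler_pM2r ?invr_gt0// sqr_frobn.
Qed.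

Lemma F_locally_lipschitz zs : exists K del : R, [/\ 0 <= K, 0 < del &
  forall z z', `|z - zs| < del -> `|z' - zs| < del -> `|F z - F z'| <= K * `|z - z'|].
Proof.
have [K1 [d1 [K10 d10 H1]]] := smooth_locally_lipschitz zs fq gradc L0.
have [K2 [d2 [K20 d20 H2]]] := convex_locally_lipschitz zs gc gconv.
exists (K1 + K2), (Num.min d1 d2); split; [exact: addr_ge0|by rewrite lt_min d10|].
move=> z z'; rewrite !lt_min => /andP[z1 z2] /andP[z1' z2'].
rewrite /F opprD addrACA (le_trans (ler_normD _ _))// mulrDl lerD//.
  exact: H1.
exact: H2.
Qed.

(** The descent inequality bounds (kappa / mu) |eta|^2 by a multiple of |eta|. Since [eta z] is not
    known to be short, [g (z + eta z)] is controlled by the lower bound valid for all increments. *)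
Lemma eta_locally_bounded zs : exists B del : R, [/\ 0 < B, 0 < del &
  forall z, M z -> `|z - zs| < del -> frobn (eta z) <= B].
Proof.
have [K [d1 [K0 d10 H1]]] := convex_locally_lipschitz zs gc gconv.
have /nbhs_normP[d2 /= d20 H2] : \forall y \near zs, `|frobn (gradf zs) - frobn (gradf y)| <= 1.
  have := @cvg_frobn R n p _ (nbhs zs) (nbhs_filter zs) gradf (gradf zs) (gradc (x := zs)).
  by move/cvgrPdist_le/(_ 1 ltr01).
pose C := frobn (gradf zs) + 1 + K.
have C0 : 0 < C by rewrite ltr_pwDl// ltr_wpDl// frobn_ge0.
have km : 0 < kappa / mu by exact: divr_gt0.
exists (C / (kappa / mu)), (Num.min d1 d2); split; [exact: divr_gt0|by rewrite lt_min d10|].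
move=> z Mz; rewrite lt_min => /andP[z1 z2].
have h1 := convex_lower_bound gconv K0 H1 (eta z) z1.
have := H2 z; rewrite /= distrC => /(_ z2); rewrite ler_norml => /andP[h2 _].
have h3 := eta_descent Mz.
have := frob_le_frobn (gradf z) (eta z); rewrite ler_norml => /andP[h4 _].
have h5 := norm_le_frobn (eta z); have e0 := frobn_ge0 (eta z).
rewrite ler_pdivlMr// mulrC.
have [->|en0] := eqVneq (frobn (eta z)) 0; first by rewrite mulr0 ltW.
have ep : 0 < frobn (eta z) by rewrite lt_neqAle eq_sym en0.
rewrite -(ler_pM2r ep) -mulrA -expr2.
have h6 : K * `|eta z| <= K * frobn (eta z) by rewrite ler_wpM2l.
have h7 : frobn (gradf z) * frobn (eta z) <= (frobn (gradf zs) + 1) * frobn (eta z).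
  by rewrite ler_wpM2r//; lra.
rewrite /C; lra.
Qed.

Lemma uniform_armijo zs eps : M zs -> 0 < eps -> exists abar del : R,
  [/\ 0 < abar, 0 < del & forall z s, M z -> `|z - zs| < del ->
     eps <= frobn (eta z) -> 0 < s < abar ->
     F (Rt z (s *: eta z)) <= F z - sigma * s * frobn (eta z) ^+ 2].
Proof.
move=> Mzs eps0.
have [K [d1 [K0 d10 HF]]] := F_locally_lipschitz zs.
have [B [d2 [B0 d20 HB]]] := eta_locally_bounded zs.
(* The slack, per unit of [s], between guaranteed and required decrease when |eta z| >= eps. Half of
   it pays for replacing the retraction by [z + s *: eta z], half for the quadratic error of [f]. *)
pose c := (kappa / mu - sigma) * eps ^+ 2.
have c0 : 0 < c by rewrite mulr_gt0 ?exprn_gt0// subr_gt0.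
pose e1 := c / (2 * (K * B + 1)).
have KB : 0 < K * B + 1 by rewrite ltr_wpDl// mulr_ge0// ltW.
have LB : 0 < L * B ^+ 2 + 1 by rewrite ltr_wpDl// mulr_ge0 ?sqr_ge0// ltW.
have e10 : 0 < e1 by rewrite divr_gt0// mulr_gt0.
have T0 : tangent M zs 0 by exact: (subspace0 (PT Mzs)).
have TZ z a v : M z -> tangent M z v -> tangent M z (a *: v).
  by move=> Mz; exact: (subspaceZ (PT Mz)).
have [d3 d30 HR] := retraction_first_order Rsm Mzs TZ T0 e10.
pose d := Num.min (Num.min d1 d2) d3.
have d0 : 0 < d by rewrite !lt_min d10 d20.
have e11 : 0 < 2 * (2 + e1) by lra.
(* The three bounds allow convexity on [0, 1], keep [z + s *: eta z] and the retracted point where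
   [F] is Lipschitz, and absorb the quadratic term. *)
pose abar := Num.min 1 (Num.min (d / (2 * (2 + e1)) / B) (c / (2 * (L * B ^+ 2 + 1)))).
have abar0 : 0 < abar.
  by rewrite !lt_min ltr01 !divr_gt0// mulr_gt0.
exists abar, (d / 2); split=> //; first exact: divr_gt0.
move=> z s Mz zd en /andP[s0]; rewrite !lt_min => /andP[s1 /andP[s2 s3]].
have zd' : `|z - zs| < d by lra.
have [[zd1 zd2] zd3] : (`|z - zs| < d1 /\ `|z - zs| < d2) /\ `|z - zs| < d3.
  by move: zd'; rewrite /d !lt_min => /andP[/andP[? ?] ?].
have dd1 : d <= d1 by rewrite /d !ge_min lexx.
have dd3 : d <= d3 by rewrite /d !ge_min lexx orbT.
have eB := HB z Mz zd2.
have en0 := frobn_ge0 (eta z); have nB := le_trans (norm_le_frobn (eta z)) eB.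
have sN : `|s *: eta z| <= s * B by rewrite normrZ gtr0_norm// ler_wpM2l// ltW.
have sB : s * B < d / (2 * (2 + e1)) by rewrite -ltr_pdivlMr.
have sB2 : s * B * (2 * (2 + e1)) < d by rewrite -ltr_pdivlMr.
have sB0 : 0 < s * B by exact: mulr_gt0.
have Ts := TZ _ s _ Mz (etaT Mz).
have sNd : `|s *: eta z| < d3 by nra.
have HRz := HR z _ Mz zd3 Ts sNd.
set y := Rt z (s *: eta z) in HRz *; set z1 := z + s *: eta z.
have yz1 : y - z - s *: eta z = y - z1 by rewrite opprD addrA.
rewrite yz1 in HRz.
have z1d : `|z1 - zs| < d1.
  rewrite /z1 addrAC (le_lt_trans (ler_normD _ _))//; nra.
have yd : `|y - zs| < d1.
  rewrite -(subrKA z1) (le_lt_trans (ler_normD _ _))//.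
  have h1 : `|y - z1| <= e1 * (s * B) by rewrite (le_trans HRz)// ler_wpM2l// ltW.
  have h2 : `|z1 - zs| <= s * B + `|z - zs|.
    by rewrite /z1 addrAC (le_trans (ler_normD _ _))// [leRHS]addrC lerD2l.
  nra.
have h1 : F y - F z1 <= s * (c / 2).
  have := HF _ _ yd z1d; rewrite ler_norml => /andP[_ h]; apply: (le_trans h).
  apply: (@le_trans _ _ (K * (e1 * (s * B)))).
    by rewrite ler_wpM2l// (le_trans HRz)// ler_wpM2l// ltW.
  have -> : K * (e1 * (s * B)) = s * (c / 2) * (K * B / (K * B + 1)).
    by rewrite /e1; field; rewrite gt_eqF.
  rewrite ler_piMr//; first by rewrite mulr_ge0 ?divr_ge0// ltW.
  by rewrite ler_pdivrMr// mul1r lerDl.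
have h2 : F z1 - F z <= s * (- (kappa / mu * frobn (eta z) ^+ 2) + c / 2).
  have := fq z (s *: eta z); rewrite ler_norml -/z1 frobZr frobnZ gtr0_norm// => /andP[_ hf].
  have s01 : 0 <= s <= 1 by rewrite !ltW.
  have hg := convex_segment z (eta z) gconv s01; rewrite -/z1 in hg.
  have he := eta_descent Mz.
  have hL : L * (s * frobn (eta z)) ^+ 2 <= s * (c / 2).
    rewrite exprMn expr2 mulrCA -mulrA ler_wpM2l ?(ltW s0)//.
    apply: (@le_trans _ _ (s * (L * B ^+ 2 + 1))).
      rewrite ler_wpM2l ?(ltW s0)//; apply: (@le_trans _ _ (L * B ^+ 2)); last by rewrite lerDl.
      by rewrite ler_wpM2l ?(ltW L0)// ler_pXn2r ?nnegrE// ltW.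
    have -> : c / 2 = c / (2 * (L * B ^+ 2 + 1)) * (L * B ^+ 2 + 1).
      by field; rewrite gt_eqF.
    by rewrite ler_wpM2r ?(ltW LB)// ltW.
  have hse : s * (frob (gradf z) (eta z) + g (z + eta z) - g z) <=
             s * - (kappa / mu * frobn (eta z) ^+ 2) by rewrite ler_wpM2l// ltW.
  rewrite /F; lra.
have h3 : c <= (kappa / mu - sigma) * frobn (eta z) ^+ 2.
  rewrite ler_wpM2l ?subr_ge0 ?(ltW sigmak)//.
  by rewrite ler_pXn2r ?nnegrE// ltW.
have h4 : s * c <= s * ((kappa / mu - sigma) * frobn (eta z) ^+ 2) by rewrite ler_wpM2l// ltW.
lra.
Qed.

Lemma F_continuous : continuous F.
Proof.
move=> z; have [K [d [K0 d0 HF]]] := F_locally_lipschitz z.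
apply/(@cvgrPdist_lt _ _ _ (nbhs z) (nbhs_filter z)) => eps eps0.
have K1 : 0 < K + 1 by rewrite ltr_wpDl.
have e1 : 0 < Num.min d (eps / (K + 1)) by rewrite lt_min d0 divr_gt0.
have : \forall y \near z, `|z - y| < Num.min d (eps / (K + 1)).
  by apply/nbhs_normP; exists (Num.min d (eps / (K + 1))).
apply: filterS => y; rewrite lt_min => /andP[yd ye].
have zd : `|z - z| < d by rewrite subrr normr0.
rewrite distrC in yd; rewrite (le_lt_trans (HF _ _ zd yd))//.
apply: (@le_lt_trans _ _ ((K + 1) * `|z - y|)); first by rewrite ler_wpM2r// lerDl.
by rewrite mulrC -ltr_pdivlMr.
Qed.

Variables (zt : nat -> E) (alpha : nat -> R) (zs : E) (phi : nat -> nat).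
Hypotheses (Mzt : forall i, M (zt i)) (Mzs : M zs).
Let armijo i a := F (Rt (zt i) (a *: eta (zt i))) <= F (zt i) - sigma * a * frobn (eta (zt i)) ^+ 2.
Hypothesis line_search : forall i, exists j : nat,
  [/\ alpha i = nu ^+ j, armijo i (nu ^+ j) & forall j' : nat, (j' < j)%N -> ~ armijo i (nu ^+ j')].
Hypothesis safeguard : forall i, F (zt i.+1) <= F (Rt (zt i) (alpha i *: eta (zt i))).
Hypothesis phi_mono : forall i j, (i < j)%N -> (phi i < phi j)%N.
Hypothesis zt_cvg : (zt \o phi) @ \oo --> zs.

Let alpha_gt0 i : 0 < alpha i.
Proof. by have [j [-> _ _]] := line_search i; rewrite exprn_gt0. Qed.

Let F_step i : F (zt i.+1) <= F (zt i) - sigma * alpha i * frobn (eta (zt i)) ^+ 2.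
Proof. by apply: (le_trans (safeguard i)); have [j [-> + _]] := line_search i. Qed.

Let F_decr i j : (i <= j)%N -> F (zt j) <= F (zt i).
Proof.
move=> /subnK <-; elim: (j - i)%N => // k; apply: le_trans.
rewrite addSn (le_trans (F_step _))// gerBl mulr_ge0 ?sqr_ge0// mulr_ge0// ltW//.
Qed.

Let F_cvg : F (zt (phi j)) @[j --> \oo] --> F zs.
Proof. exact: (cvg_comp _ _ zt_cvg (@F_continuous zs)). Qed.

(** The values decrease along the whole sequence, and a subsequence of them tends to [F zs]. *)
Let F_lower i : F zs <= F (zt i).
Proof.
have phi_ge j : (j <= phi j)%N.
  by elim: j => // j IH; apply: (leq_ltn_trans IH); exact: phi_mono.
apply: (cvgr_to_le F_cvg).
by exists i => // j /= ij; apply: F_decr; exact: leq_trans (phi_ge j).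
Qed.

Lemma eta_cluster0 eps : 0 < eps -> exists z, [/\ M z, `|z - zs| < eps & frobn (eta z) < eps].
Proof.
move=> eps0; have [abar [del [abar0 del0 H]]] := uniform_armijo Mzs eps0.
apply: contrapT => nex.
have far z : M z -> `|z - zs| < eps -> eps <= frobn (eta z).
  by move=> Mz zd; rewrite leNgt; apply/negP => ez; apply: nex; exists z.
(* Either the first trial step 1 is accepted, or the trial just before the accepted one failed and
   so was at least [abar]. *)
pose be := Num.min 1 (nu * abar).
have be0 : 0 < be by rewrite lt_min ltr01 mulr_gt0.
have alphab i : `|zt i - zs| < del -> `|zt i - zs| < eps -> be <= alpha i.
  move=> d1 d2; have [[|j] [-> _ nA]] := line_search i; first by rewrite expr0 ge_min lexx.
  rewrite ge_min exprS; apply/orP; right; rewrite ler_wpM2l ?(ltW nu0)// leNgt.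
  apply/negP => ja; apply: (nA j (ltnSn j)); apply: H => //; first exact: far.
  by rewrite exprn_gt0.
(* The least decrease of a step taken near [zs]; one such step from a value below [F zs + q] would
   fall under [F zs]. *)
pose q := sigma * be * eps ^+ 2.
have q0 : 0 < q by rewrite !mulr_gt0// exprn_gt0.
have H1 : \forall j \near \oo, `|zs - zt (phi j)| < Num.min del eps.
  have me0 : 0 < Num.min del eps by rewrite lt_min del0.
  by move/cvgrPdist_lt/(_ _ me0) : zt_cvg.
have H2 : \forall j \near \oo, `|F zs - F (zt (phi j))| < q.
  by move/cvgrPdist_lt/(_ _ q0) : F_cvg.
near \oo => j.
have : `|zs - zt (phi j)| < Num.min del eps by near: j.
rewrite distrC lt_min => /andP[j1 j2].
have : `|F zs - F (zt (phi j))| < q by near: j.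
rewrite ltr_norml => /andP[h1 _].
have h2 := F_step (phi j); have h3 := F_lower (phi j).+1.
have h4 := alphab _ j1 j2; have h5 := far _ (Mzt _) j2.
have h6 : q <= sigma * alpha (phi j) * frobn (eta (zt (phi j))) ^+ 2.
  rewrite /q -!mulrA ler_wpM2l ?(ltW sigma0)// ler_pM ?(ltW be0) ?sqr_ge0//.
  by rewrite ler_pXn2r ?nnegrE ?frobn_ge0// ltW.
lra.
Unshelve. all: by end_near. Qed.

(** Minimality of [eta_z] against tangent vectors [v'] tending to [v], at points [z] tending to
    [zs]. The quadratic term of [eta_z] is dropped as nonnegative; that of [v'] is replaced by its
    spectral bound, which is continuous. *)
Lemma tangent_optimality v : tangent M zs v ->
  0 <= frob (gradf zs) v + kappat / (2 * mu) * frob v v + g (zs + v) - g zs.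
Proof.
move=> Tv.
have ex m : exists zv : E * E, [/\ M zv.1, `|zv.1 - zs| < m.+1%:R^-1,
    frobn (eta zv.1) < m.+1%:R^-1, `|v - zv.2| < m.+1%:R^-1 & tangent M zv.1 zv.2].
  have m0 : 0 < m.+1%:R^-1 :> R by rewrite invr_gt0.
  have /nbhs_normP[d /= d0 Hd] := tangent_lower_semicontinuous Memb Mzs Tv m0.
  have d1 : 0 < Num.min d m.+1%:R^-1 by rewrite lt_min d0.
  have [z [Mz zd ez]] := eta_cluster0 d1.
  move: zd ez; rewrite !lt_min => /andP[zd zm] /andP[_ em].
  have [|v' v'v Tv'] := Hd z _ Mz; first by rewrite /= distrC.
  by exists (z, v').
have {ex}/choice[zv zvP] := ex.
have small (a : nat -> E) A : (forall m, `|A - a m| < m.+1%:R^-1) -> a @ \oo --> A.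
  move=> aA; apply/cvgrPdist_lt => e e0.
  have := near_infty_natSinv_lt (PosNum e0); apply: filterS => m /=; exact: lt_trans.
have zc : (fun m => (zv m).1) @ \oo --> zs.
  by apply: small => m; rewrite distrC; have [] := zvP m.
have vc : (fun m => (zv m).2) @ \oo --> v by apply: small => m; have [] := zvP m.
have ec : (fun m => eta (zv m).1) @ \oo --> (0 : E).
  apply: small => m; rewrite sub0r normrN (le_lt_trans (norm_le_frobn _))//.
  by have [] := zvP m.
have gz : (fun m => gradf (zv m).1) @ \oo --> gradf zs.
  exact: (cvg_comp _ _ zc (@gradc zs)).
have lhs : frob (gradf (zv m).1) (eta (zv m).1) + g ((zv m).1 + eta (zv m).1) @[m --> \oo]
    --> frob (gradf zs) 0 + g (zs + 0).
  apply: cvgD; first exact: cvg_frob.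
  exact: (cvg_comp _ _ (cvgD zc ec) (@gc (zs + 0))).
have rhs : frob (gradf (zv m).1) (zv m).2 + kappat / (2 * mu) * frob (zv m).2 (zv m).2
     + g ((zv m).1 + (zv m).2) @[m --> \oo]
    --> frob (gradf zs) v + kappat / (2 * mu) * frob v v + g (zs + v).
  apply: cvgD; last exact: (cvg_comp _ _ (cvgD zc vc) (@gc (zs + v))).
  apply: cvgD; first exact: cvg_frob.
  by apply: cvgM; [exact: cvg_cst|exact: cvg_frob].
have mu2 : 0 < 2 * mu by rewrite mulr_gt0.
have : frob (gradf zs) 0 + g (zs + 0) <=
       frob (gradf zs) v + kappat / (2 * mu) * frob v v + g (zs + v).
  apply: (ler_cvg_to lhs rhs); near=> m.
  have [Mz _ _ _ Tv'] := zvP m.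
  have h1 := etamin Mz Tv'.
  have /andP[h2 _] := Wk Mz (etaT Mz); have /andP[_ h3] := Wk Mz Tv'.
  have h4 : 0 <= 1 / (2 * mu) * frob (eta (zv m).1) (W (zv m).1 (eta (zv m).1)).
    rewrite mulr_ge0 ?divr_ge0 ?(ltW mu2)// (le_trans _ h2)// mulr_ge0 ?frob_ge0//.
    exact: ltW.
  have h5 : 1 / (2 * mu) * frob (zv m).2 (W (zv m).1 (zv m).2) <=
            kappat / (2 * mu) * frob (zv m).2 (zv m).2.
    have -> : kappat / (2 * mu) * frob (zv m).2 (zv m).2 =
      1 / (2 * mu) * (kappat * frob (zv m).2 (zv m).2) by ring.
    by rewrite ler_wpM2l ?divr_ge0 ?(ltW mu2).
  lra.
by rewrite frob0r addr0 add0r; lra.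
Unshelve. all: by end_near. Qed.

Lemma clarke_stationary : exists xi, clarke_subdiff F zs xi /\ P zs xi = 0.
Proof.
pose phi0 v := frob (gradf zs) v + g (zs + v) - g zs.
have phi0_convex : convex_fun phi0.
  move=> v w a a01; rewrite /phi0 frobDr !frobZr.
  have := gconv (zs + v) (zs + w) a01.
  have -> : a *: (zs + v) + (1 - a) *: (zs + w) = zs + (a *: v + (1 - a) *: w).
    by rewrite !scalerDr addrACA -scalerDl [a + _]addrC subrK scale1r.
  lra.
(* At [s *: v] the quadratic term carries s^2, while by convexity the rest is at most [s * phi0 v];
   divide by [s] and let it be small. *)
have phi0_ge0 v : tangent M zs v -> 0 <= phi0 v.
  move=> Tv; pose C := `|kappat / (2 * mu) * frob v v| + 1.
  have C0 : 0 < C by rewrite ltr_wpDl.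
  apply/ler_addgt0Pr => eps eps0.
  pose s := Num.min 1 (eps / C).
  have s0 : 0 < s by rewrite lt_min ltr01 divr_gt0.
  have s1 : s <= 1 by rewrite ge_min lexx.
  have sC : s * C <= eps by rewrite -ler_pdivlMr// ge_min lexx orbT.
  have := tangent_optimality (subspaceZ (PT Mzs) s Tv).
  have s01 : 0 <= s <= 1 by rewrite s1 ltW.
  have := convex_segment zs v gconv s01.
  rewrite !frobZr frobZl => h1 h2.
  have h3 : kappat / (2 * mu) * frob v v <= C.
    by rewrite (le_trans (ler_norm _))// lerDl.
  have h4 : s * (kappat / (2 * mu) * frob v v) <= s * C by rewrite ler_pM2l.
  have h5 : s * (s * (kappat / (2 * mu) * frob v v)) <= s * eps.
    by rewrite ler_pM2l// (le_trans h4).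
  rewrite -(ler_pM2l s0) mulr0 /phi0; lra.
have [xi [xiphi xiT]] := convex_separation (PT Mzs) phi0_convex phi0_ge0.
exists xi; split; first exact: clarke_subdiff_sum L0 (fq zs) xiphi.
have PTx := (PT Mzs xi).1; apply: frob_eq0.
by rewrite (frob_proj (PT Mzs))// xiT.
Qed.

End Convergence.

(** * Feasibility of the iterates and conclusion *)

Lemma closed_limit (R : realType) n p (M : set 'M[R]_(n, p)) (u : nat -> 'M[R]_(n, p)) zs :
  compact M -> (forall i, M (u i)) -> u @ \oo --> zs -> M zs.
Proof.
move=> cM uM uz; have clM : closed M.
  by apply: compact_closed => //; exact: norm_hausdorff.
by apply: closed_cvg uz => //; apply: nearW.
Qed.

Theorem theorem1 (R : realType) (n p : nat)
  (M : set 'M[R]_(n, p)) (Rt : 'M[R]_(n, p) -> 'M[R]_(n, p) -> 'M[R]_(n, p))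
  (f g : 'M[R]_(n, p) -> R) (gradf : 'M[R]_(n, p) -> 'M[R]_(n, p)) (L : R)
  (P : 'M[R]_(n, p) -> 'M[R]_(n, p) -> 'M[R]_(n, p))
  (W : 'M[R]_(n, p) -> 'M[R]_(n, p) -> 'M[R]_(n, p)) (kappa kappat : R)
  (eta : 'M[R]_(n, p) -> 'M[R]_(n, p))
  (mu sigma nu : R) (N : nat) (x0 : 'M[R]_(n, p))
  (x y xa ya : nat -> 'M[R]_(n, p)) (t ta : nat -> R)
  (zt : nat -> 'M[R]_(n, p)) (alpha : nat -> R) (zs : 'M[R]_(n, p)) :
  let F := fun z => f z + g z in
  (* the manifold and the retraction *)
  embedded_submanifold M -> compact M ->
  smooth_retraction M Rt ->
  (* f is C^1 with L-Lipschitz (Euclidean) gradient gradf *)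
  (forall z, differentiable f z) ->
  (forall z v, 'd f z v = frob (gradf z) v) ->
  continuous gradf -> 0 < L ->
  (forall z1 z2, frobn (gradf z1 - gradf z2) <= L * frobn (z1 - z2)) ->
  (* g continuous and convex, F coercive *)
  continuous g -> convex_fun g ->
  (forall B : R, exists r : R, forall z, r <= frobn z -> B <= F z) ->
  (* P z is the orthogonal projection onto T_z M *)
  (forall z v, M z -> is_orth_proj (tangent M z) v (P z v)) ->
  (* the weights W_z *)
  0 < kappa -> kappa <= kappat ->
  (forall z, M z ->
     [/\ (forall e, tangent M z e -> tangent M z (W z e)),
         (forall (a : R) e1 e2, tangent M z e1 -> tangent M z e2 ->
             W z (a *: e1 + e2) = a *: W z e1 + W z e2),
         (forall e1 e2, tangent M z e1 -> tangent M z e2 ->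
             frob e1 (W z e2) = frob (W z e1) e2),
         (forall e, tangent M z e -> e != 0 -> 0 < frob e (W z e)) &
         (forall (lam : R) e, tangent M z e -> e != 0 -> W z e = lam *: e ->
             kappa <= lam <= kappat)]) ->
  (* parameters *)
  0 < mu -> mu <= 1 / L -> 0 < sigma -> sigma < 1 -> sigma < kappa / mu ->
  0 < nu -> nu < 1 -> (0 < N)%N ->
  (* eta z is the proximal direction (minimizer over T_z M) *)
  (forall z, M z -> tangent M z (eta z) /\
     forall e, tangent M z e ->
       frob (P z (gradf z)) (eta z) + 1 / (2 * mu) * frob (eta z) (W z (eta z))
         + g (z + eta z)
       <= frob (P z (gradf z)) e + 1 / (2 * mu) * frob e (W z e) + g (z + e)) ->
  (* AManPG: initialization *)
  M x0 -> x 0%N = x0 -> y 0%N = x0 -> t 0%N = 1 -> zt 0%N = x0 ->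
  (* step (a), safeguard at k = i N; (xa k, ya k, ta k) are the values of
     (x_k, y_k, t_k) after step (a) *)
  (forall i : nat,
     let armijo := fun a : R =>
       F (Rt (zt i) (a *: eta (zt i)))
         <= F (zt i) - sigma * a * frobn (eta (zt i)) ^+ 2 in
     let w := Rt (zt i) (alpha i *: eta (zt i)) in
     [/\ (exists j : nat, [/\ alpha i = nu ^+ j, armijo (nu ^+ j) &
            forall j' : nat, (j' < j)%N -> ~ armijo (nu ^+ j')]),
         F w < F (x (i * N)%N) ->
           [/\ xa (i * N)%N = w, ya (i * N)%N = w & ta (i * N)%N = 1],
         F (x (i * N)%N) <= F w ->
           [/\ xa (i * N)%N = x (i * N)%N, ya (i * N)%N = y (i * N)%N
             & ta (i * N)%N = t (i * N)%N] &
         zt i.+1 = xa (i * N)%N]) ->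
  (forall k : nat, ~~ (N %| k)%N ->
     [/\ xa k = x k, ya k = y k & ta k = t k]) ->
  (* step (b) *)
  (forall k : nat,
     [/\ x k.+1 = Rt (ya k) (eta (ya k)),
         t k.+1 = (Num.sqrt (4 * ta k ^+ 2 + 1) + 1) / 2 &
         exists xi, [/\ tangent M (x k.+1) xi, Rt (x k.+1) xi = xa k &
             y k.+1 = Rt (x k.+1) (((1 - ta k) / t k.+1) *: xi)]]) ->
  (* zs is an accumulation point of (zt i) = (z_{iN}) *)
  (exists phi : nat -> nat, (forall i j, (i < j)%N -> (phi i < phi j)%N) /\
     (zt \o phi) @ \oo --> zs) ->
  (* 0 \in P_{T_zs M} (Clarke subdifferential of F at zs) *)
  exists xi, clarke_subdiff F zs xi /\ P zs xi = 0.
Proof.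
move=> F Memb Mc Rsm fd fE gradc L0 fL gc gconv _ PT kappa0 _ HW mu0 _ sigma0 _ sigmak
  nu0 nu1 N0 Heta Mx0 x0E y0E _ z0E stepa stepa' stepb [phi [phi_mono zt_cvg]].
have PT' z : M z -> forall v, is_orth_proj (tangent M z) v (P z v).
  by move=> Mz v; exact: PT.
have TZ z (a : R) v : M z -> tangent M z v -> tangent M z (a *: v).
  by move=> Mz; exact: (subspaceZ (PT' z Mz)).
have Rm z v : M z -> tangent M z v -> M (Rt z v) by case: Rsm => + _ _ _; apply.
have etaT z : M z -> tangent M z (eta z) by move=> /Heta[].
have wM i : M (zt i) -> M (Rt (zt i) (alpha i *: eta (zt i))).
  by move=> Mz; apply: (Rm) => //; apply: TZ => //; exact: etaT.
have xyaM k : M (x k) -> M (y k) -> (forall i, (i * N)%N = k -> M (zt i)) ->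
    M (xa k) /\ M (ya k).
  move=> Mx My Mz; have [/dvdnP[i kE]|Nk] := boolP (N %| k)%N; last first.
    by have [-> -> _] := stepa' k Nk.
  have [_ lt ge _] := stepa i; rewrite -kE in lt ge.
  have [/lt[-> -> _]|/ge[-> -> _]//] :=
    ltP (F (Rt (zt i) (alpha i *: eta (zt i)))) (F (x k)).
  by have := wM i (Mz i (esym kE)).
(* Strong induction, because [zt i.+1] is the [xa] of iteration [i * N], lying [N] steps before the
   index [i.+1 * N] at which it is used. *)
have allM k : [/\ M (x k), M (y k) & forall i, (i * N)%N = k -> M (zt i)].
  elim/ltn_ind: k => -[_|k IH].
    rewrite x0E y0E; split=> // i /eqP; rewrite muln_eq0 => /orP[/eqP->|/eqP N00].
      by rewrite z0E.
    by rewrite N00 in N0.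
  have [Mx My Mz] := IH k (ltnSn k); have [Mxa Mya] := xyaM k Mx My Mz.
  have [xE _ [xi [Txi _ yE]]] := stepb k.
  have Mx1 : M (x k.+1) by rewrite xE; apply: Rm => //; exact: etaT.
  split=> //; first by rewrite yE; apply: Rm => //; exact: TZ.
  case=> [//|i iN]; have [_ _ _ ->] := stepa i.
  have ik : (i * N < k.+1)%N by rewrite -iN mulSn -[X in (X < _)%N]add0n ltn_add2r.
  by have [Mx' My' Mz'] := IH _ ik; have [] := xyaM _ Mx' My' Mz'.
have ztM i : M (zt i) by have [_ _] := allM (i * N)%N; exact.
have Mzs : M zs by apply: closed_limit Mc _ zt_cvg => i; exact: ztM.
have fq := quadratic_bound fd fE L0 fL.
apply: (@clarke_stationary R n p M Rt f g gradf L P W kappa kappat eta mu sigma nu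
  Memb Rsm fq gradc L0 gc gconv PT' kappa0 _ _ mu0 sigma0 sigmak nu0 etaT _
  zt alpha zs phi ztM Mzs _ _ phi_mono zt_cvg).
- by move=> z Mz; have [_ Wlin _ _ _] := HW z Mz.
- move=> z Mz; have [WT Wlin Wsym _ Weig] := HW z Mz.
  exact: rayleigh_bounds (PT' z Mz) WT Wlin Wsym Weig.
(* Against tangent vectors the Riemannian gradient and [gradf] have the same inner products. *)
- move=> z Mz e Te; have [_ /(_ e Te)] := Heta z Mz.
  by rewrite !(frob_proj (PT' z Mz))//; exact: etaT.
- by move=> i; have [] := stepa i.
(* [xa (i * N)] is whichever of [w] and [x (i * N)] has the smaller value of [F]. *)
- move=> i; have [_ lt ge ->] := stepa i.
  have [h|h] := ltP (F (Rt (zt i) (alpha i *: eta (zt i)))) (F (x (i * N)%N)).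
    by have [-> _ _] := lt h.
  by have [-> _ _] := ge h.
Qed.
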